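(* Let $d\geq 1$ be an integer, let $\epsilon,C_1,C_2>0$ and $M\geq 0$. There is a constant $A$, depending only on $\epsilon,C_1,C_2,M$, and $d$, such that the following holds. Let $\{f^{(Q)}\}_{Q\in\mathcal{D}_d}$ be a family of differentiable functions $f^{(Q)}:\mathbf{R}^d\to\mathbf{C}$ indexed over the dyadic cubes $\mathcal{D}_d$ in $\mathbf{R}^d$, where each $f^{(Q)}$ satisfies $\int_{\mathbf{R}^d} f^{(Q)}\,dx=0$ and, for all $x\in\mathbf{R}^d$, $$|f^{(Q)}(x)|\leq C_1(1+|x|)^{-d-\epsilon}$$ and $$|\nabla f^{(Q)}(x)|\leq C_2(1+|x|)^M.$$ For each $Q\in\mathcal{D}_d$, define $$g^{(Q)}(x):=\frac{f^{(Q)}\bigl((x-x_Q)/\ell(Q)\bigr)}{|Q|^{1/2}},\qquad x\in\mathbf{R}^d.$$ Then, for all finite sequences $\{\lambda_Q\}_{Q\in\mathcal{D}_d}\subset\mathbf{C}$, $$\int_{\mathbf{R}^d}\Bigl|\sum_{Q}\lambda_Q\, g^{(Q)}(x)\Bigr|^2\,dx\leq A\sum_{Q}|\lambda_Q|^2.$$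
   Context: $\mathcal{D}_d$ is the collection of all dyadic cubes in $\mathbf{R}^d$, i.e. cubes of the form $\prod_{i=1}^d[j_i2^k,(j_i+1)2^k)$ with $k,j_1,\dots,j_d\in\mathbf{Z}$. For $Q\in\mathcal{D}_d$, $x_Q$ is the center of $Q$, $\ell(Q)$ is its sidelength, and $|Q|=\ell(Q)^d$ is its Lebesgue measure. A ''finite sequence'' $\{\lambda_Q\}_{Q\in\mathcal{D}_d}$ is one in which only finitely many $\lambda_Q$ are nonzero. $|x|$ is the Euclidean norm on $\mathbf{R}^d$, and $|\nabla f|=\bigl(\sum_{i=1}^d|\partial_i f|^2\bigr)^{1/2}$. *)

(* Defs.v *)
From HB Require Import structures.
From mathcomp Require Import all_boot all_order all_algebra.
From mathcomp Require Import all_classical all_reals all_analysis.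
From mathcomp Require Import complex.

Set Implicit Arguments.
Unset Strict Implicit.
Unset Printing Implicit Defensive.

Import Order.TTheory GRing.Theory Num.Theory.
Import numFieldNormedType.Exports.

Local Open Scope classical_set_scope.
Local Open Scope ring_scope.

(* The complex numbers as a normed space over R; [Rcomplex R] is [R[i]] with
   its R-valued modulus, so that [differentiable] and ['D_v] apply to functions
   into it. *)
Section Rcomplex_normedModule.
Variable R : realType.

Lemma Rcomplex_normrZ (l : R) (x : Rcomplex R) : `|l *: x| = `|l| * `|x|.
Proof.
case: x => a b; rewrite [LHS]/Num.norm [in RHS]/Num.norm /= !exprMn -mulrDr.
by rewrite sqrtrM ?sqr_ge0// sqrtr_sqr.
Qed.

HB.instance Definition _ :=
  PseudoMetric.copy (Rcomplex R) (pseudoMetric_normed (Rcomplex R)).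
HB.instance Definition _ := isPointed.Build (Rcomplex R) 0.
HB.instance Definition _ :=
  NormedZmod_PseudoMetric_eq.Build R (Rcomplex R) erefl.
HB.instance Definition _ :=
  PseudoMetricNormedZmod_Lmodule_isNormedModule.Build R (Rcomplex R)
    Rcomplex_normrZ.

End Rcomplex_normedModule.

(* 'rV[T]_n gets the sigma-algebra generated by its coordinates; for T := R
   this is the Borel sigma-algebra of R^n. *)
Section measurable_rV.
Context {d} {T : measurableType d}.
Variable n : nat.

Let coord : 'I_n -> 'rV[T]_n -> T := fun i x => x ord0 i.

Let rV_set0 : g_sigma_preimage coord set0.
Proof. exact: sigma_algebra0. Qed.

Let rV_setC A : g_sigma_preimage coord A -> g_sigma_preimage coord (~` A).
Proof. exact: sigma_algebraC. Qed.

Let rV_bigcup (F : _^nat) : (forall i, g_sigma_preimage coord (F i)) ->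
  g_sigma_preimage coord (\bigcup_i (F i)).
Proof. exact: sigma_algebra_bigcup. Qed.

HB.instance Definition _ := @isMeasurable.Build (measure_tuple_display d)
  'rV[T]_n (g_sigma_preimage coord) rV_set0 rV_setC rV_bigcup.

Lemma measurable_coord (i : 'I_n) :
  measurable_fun [set: 'rV[T]_n] (fun x => x ord0 i).
Proof.
move=> _ Y mY; rewrite setTI; apply: sub_sigma_algebra => /=.
rewrite -bigcup_seq/=; exists i => /=; first by rewrite mem_index_enum.
by exists Y => //; rewrite setTI.
Qed.

Lemma measurable_fun_rV d' (S : measurableType d') (f : S -> 'rV[T]_n) :
  (forall i, measurable_fun setT (fun s => f s ord0 i)) ->
  measurable_fun setT f.
Proof.
move=> mf.
have H : g_sigma_preimage (fun i => coord i \o f) `<=` measurable.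
  apply: smallest_sub; first exact: sigma_algebra_measurable.
  rewrite -bigcup_seq; apply: bigcup_sub => i _ A [B mB <-].
  exact: mf.
move=> _ A mA; apply: H; rewrite g_sigma_preimage_comp.
by exists A.
Qed.

End measurable_rV.

Section lebesgue_rV.
Context {R : realType}.

Definition cons_rV n (p : R * 'rV[R]_n) : 'rV[R]_n.+1 :=
  row_mx p.1%:M p.2 : 'rV[R]_(1 + n).

Definition uncons_rV n (v : 'rV[R]_n.+1) : R * 'rV[R]_n :=
  (v ord0 ord0, \row_j v ord0 (lift ord0 j)).

Lemma cons_rV0 n (p : R * 'rV[R]_n) : cons_rV p ord0 ord0 = p.1.
Proof.
transitivity (row_mx p.1%:M p.2 ord0 (lshift n (ord0 : 'I_1))).
  by congr fun_of_matrix; exact/val_inj.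
by rewrite row_mxEl mxE eqxx mulr1n.
Qed.

Lemma cons_rVS n (p : R * 'rV[R]_n) j :
  cons_rV p ord0 (lift ord0 j) = p.2 ord0 j.
Proof.
transitivity (row_mx p.1%:M p.2 ord0 (rshift 1 j)).
  by congr fun_of_matrix; exact/val_inj.
by rewrite row_mxEr.
Qed.

Lemma cons_rVK n : cancel (@cons_rV n) (@uncons_rV n).
Proof.
move=> [a v]; rewrite /uncons_rV cons_rV0; congr pair.
by apply/rowP => j; rewrite mxE cons_rVS.
Qed.

Lemma measurable_cons_rV n : measurable_fun setT (@cons_rV n).
Proof.
apply: measurable_fun_rV => i; case: (unliftP ord0 i) => [j|] ->.
- under eq_fun do rewrite cons_rVS.
  by apply: (measurableT_comp (measurable_coord j)); exact: measurable_snd.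
- by under eq_fun do rewrite cons_rV0; exact: measurable_fst.
Qed.

Lemma measurable_uncons_rV n : measurable_fun setT (@uncons_rV n).
Proof.
apply: measurable_fun_pair; first exact: measurable_coord.
apply: measurable_fun_rV => i; under eq_fun do rewrite mxE.
exact: measurable_coord.
Qed.

Section lebesgue_rV_succ.
Variables (n : nat) (mu : {sigma_finite_measure set 'rV[R]_n -> \bar R}).

Definition lebesgue_rV_succ : set 'rV[R]_n.+1 -> \bar R :=
  pushforward (@lebesgue_measure R \x mu)%E (@cons_rV n).

Let succ0 : lebesgue_rV_succ set0 = 0%E.
Proof. by apply: measure0; exact: measurable_cons_rV. Qed.

Let succ_ge0 A : (0 <= lebesgue_rV_succ A)%E.
Proof. by apply: measure_ge0; exact: measurable_cons_rV. Qed.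

Let succ_sigma_additive : semi_sigma_additive lebesgue_rV_succ.
Proof.
by apply: measure_semi_sigma_additive; exact: measurable_cons_rV.
Qed.

HB.instance Definition _ := isMeasure.Build _ _ _ lebesgue_rV_succ
  succ0 succ_ge0 succ_sigma_additive.

Let succ_sigma_finite : sigma_finite setT lebesgue_rV_succ.
Proof.
have /sigma_finiteP[F [FT ndF Foo]] := sigma_finiteT (@lebesgue_measure R).
have /sigma_finiteP[G [GT ndG Goo]] := sigma_finiteT mu.
exists (fun k => @uncons_rV n @^-1` (F k `*` G k)).
  rewrite -preimage_bigcup; apply/esym; rewrite -subTset => v _.
  have [k _ Fk] : (\bigcup_k F k) (uncons_rV v).1 by rewrite -FT.
  have [l _ Gl] : (\bigcup_k G k) (uncons_rV v).2 by rewrite -GT.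
  exists (maxn k l) => //; split.
    by move: Fk; exact/subsetPset/ndF/leq_maxl.
  by move: Gl; exact/subsetPset/ndG/leq_maxr.
move=> k; have [mFk Fk] := Foo k; have [mGk Gk] := Goo k.
have mFG : measurable (F k `*` G k) by exact: measurableX.
split.
  by rewrite -[X in measurable X]setTI; exact: measurable_uncons_rV.
rewrite /lebesgue_rV_succ /pushforward -comp_preimage.
rewrite (_ : _ \o _ = idfun); last first.
  by apply/funext => p /=; rewrite cons_rVK.
by rewrite preimage_id product_measure1E// lte_mul_pinfty// ge0_fin_numE.
Qed.

HB.instance Definition _ :=
  Measure_isSigmaFinite.Build _ _ _ lebesgue_rV_succ succ_sigma_finite.

End lebesgue_rV_succ.

(* Lebesgue measure on R^n as an iterated product; it is characterised by
   [lebesgue_rV_box]. *)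
Fixpoint lebesgue_rV n : {sigma_finite_measure set 'rV[R]_n -> \bar R} :=
  if n is n'.+1 return {sigma_finite_measure set 'rV[R]_n -> \bar R}
  then lebesgue_rV_succ (lebesgue_rV n')
  else @dirac _ 'rV[R]_0 0 R.

Lemma lebesgue_rV_box n (a b : 'I_n -> R) : (forall i, a i <= b i) ->
  lebesgue_rV n [set x | forall i, x ord0 i \in `[a i, b i[%R] =
  (\prod_(i < n) (b i - a i))%:E.
Proof.
elim: n a b => [|n IHn] a b ab.
  by rewrite /= diracE big_ord0 mem_set// => -[].
rewrite /= /lebesgue_rV_succ /pushforward.
pose B := [set x : 'rV[R]_n |
  forall i, x ord0 i \in `[a (lift ord0 i), b (lift ord0 i)[%R].
have mB : measurable B.
  rewrite (_ : B = \bigcap_i [set x | x ord0 i \in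
      `[a (lift ord0 i), b (lift ord0 i)[%R]); last first.
    by apply/seteqP; split => [x Bx i _|x Bx i]; exact: Bx.
  apply: fin_bigcap_measurable => // i _.
  rewrite -[X in measurable X]setTI.
  exact: (measurable_coord i measurableT (measurable_itv _)).
rewrite (_ : _ @^-1` _ = [set` `[a ord0, b ord0[%R] `*` B); last first.
  apply/seteqP; split => [p /= pab|p /= [p1 p2] i].
    split; first by have := pab ord0; rewrite cons_rV0.
    by move=> i; have := pab (lift ord0 i); rewrite cons_rVS.
  by case: (unliftP ord0 i) => [j|] ->; rewrite ?cons_rVS ?cons_rV0//; exact: p2.
rewrite product_measure1E//.
rewrite [X in (_ * X)%E](IHn (a \o lift ord0) (b \o lift ord0)); last first.
  by move=> i; exact: ab.
rewrite big_ord_recl EFinM; congr (_ * _)%E.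
rewrite [LHS](lebesgue_measure_itv `[a ord0, b ord0[) /= lte_fin lt_neqAle ab andbT.
by case: eqVneq => [->|]; rewrite ?subrr// EFinB.
Qed.

End lebesgue_rV.

Section dyadic.
Variable d : nat.

(* [(k, j)] stands for the cube with sides [j_i 2^k, (j_i + 1) 2^k); the
   encoding is one-to-one when d > 0, see [dyadic_cube_inj]. *)
Definition dyadic := (int * 'rV[int]_d)%type.

Variable R : realType.
Implicit Type Q : dyadic.

Definition side Q : R := 2 ^ Q.1.

Definition dyadic_cube Q : set 'rV[R]_d :=
  [set x | forall i, (Q.2 ord0 i)%:~R * side Q <= x ord0 i
                     < ((Q.2 ord0 i)%:~R + 1) * side Q].

Definition center_of Q : 'rV[R]_d :=
  \row_i (((Q.2 ord0 i)%:~R + 2^-1) * side Q).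

Definition volume Q : R := side Q ^+ d.

Lemma side_gt0 Q : 0 < side Q.
Proof. by rewrite exprz_gt0. Qed.

Lemma dyadic_cube_inj : (0 < d)%N -> injective dyadic_cube.
Proof.
move=> d_gt0 Q Q' QQ'.
have corner P : dyadic_cube P (\row_i ((P.2 ord0 i)%:~R * side P)).
  by move=> l; rewrite mxE lexx /= mulrDl mul1r ltrDl side_gt0.
have eq_corner i : (Q.2 ord0 i)%:~R * side Q = (Q'.2 ord0 i)%:~R * side Q'.
  apply/le_anti/andP; split.
    have := corner Q'; rewrite -QQ' => /(_ i).
    by rewrite mxE => /andP[].
  have := corner Q; rewrite QQ' => /(_ i).
  by rewrite mxE => /andP[].
have side_le (P P' : dyadic) : (forall i,
      (P.2 ord0 i)%:~R * side P = (P'.2 ord0 i)%:~R * side P') ->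
    dyadic_cube P = dyadic_cube P' -> side P' <= side P.
  move=> PP' cPP'; rewrite leNgt; apply/negP => ltPP'.
  have : dyadic_cube P' (\row_i (((P.2 ord0 i)%:~R + 1) * side P)).
    move=> i; rewrite mxE !mulrDl !mul1r PP' ltrD2l ltPP' andbT.
    by rewrite lerDl ltW// side_gt0.
  rewrite -cPP' => /(_ (Ordinal d_gt0)).
  by rewrite mxE ltxx andbF.
have sideE : side Q = side Q'.
  by apply/le_anti/andP; split; apply: side_le.
have k_eq : Q.1 = Q'.1.
  by move: sideE; apply: ieexprIz => //; rewrite pnatr_eq1.
case: Q Q' QQ' corner eq_corner sideE k_eq => [k u] [k' u'] /=.
move=> _ _ eq_corner sideE ->; congr pair; apply/rowP => i.
have := eq_corner i; rewrite sideE => /mulIf.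
by rewrite gt_eqF ?side_gt0// => /(_ isT)/intr_inj.
Qed.

Lemma lebesgue_dyadic_cube Q : lebesgue_rV d (dyadic_cube Q) = (volume Q)%:E.
Proof.
rewrite [LHS](@lebesgue_rV_box _ _ (fun i => (Q.2 ord0 i)%:~R * side Q)
  (fun i => ((Q.2 ord0 i)%:~R + 1) * side Q)); last first.
  by move=> i; rewrite mulrDl mul1r lerDl ltW// side_gt0.
under eq_bigr do rewrite mulrDl mul1r addrAC subrr add0r.
by rewrite prodr_const card_ord.
Qed.

End dyadic.

Section function_space.
Variables (R : realType) (d : nat).
Implicit Type f : 'rV[R]_d -> Rcomplex R.

(* The canonical norm of 'rV[R]_d is the sup norm, hence [enorm]. *)
Definition enorm (x : 'rV[R]_d) : R := Num.sqrt (\sum_i x ord0 i ^+ 2).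

Definition partial f (i : 'I_d) (x : 'rV[R]_d) : Rcomplex R :=
  'D_(delta_mx ord0 i) f x.

Definition grad_norm f x : R := Num.sqrt (\sum_i `|partial f i x| ^+ 2).

(* Real and imaginary parts are integrated separately; the value is meaningful
   for integrable [f]. *)
Definition cintegral f : Rcomplex R :=
  Complex (\int[lebesgue_rV d]_x complex.Re (f x))
          (\int[lebesgue_rV d]_x complex.Im (f x)).

Definition atom f (Q : dyadic d) (x : 'rV[R]_d) : Rcomplex R :=
  (Num.sqrt (volume R Q))^-1 *: f ((side R Q)^-1 *: (x - center_of R Q)).

End function_space.

(* Main.v *)
Require Import Defs.
From HB Require Import structures.
From mathcomp Require Import all_boot all_order all_algebra.
From mathcomp Require Import all_classical all_reals all_analysis.
From mathcomp Require Import complex.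
From mathcomp Require Import finmap measurable_realfun ring lra.

Set Implicit Arguments.
Unset Strict Implicit.
Unset Printing Implicit Defensive.

Import Order.TTheory GRing.Theory Num.Theory.
Import numFieldNormedType.Exports.

Local Open Scope classical_set_scope.
Local Open Scope ring_scope.

(* Almost orthogonality, by Schur's test in a form that avoids any pointwise
   kernel estimate.  Expand the square and write the (Q, P) term, with Q the
   smaller cube, as u_Q (u_P - u_P(x_Q)) plus a constant times u_Q; the latter
   integrates to 0 by cancellation.  Interpolating the decay of f with the
   polynomial bound on its gradient gives a Hoelder estimate for f of some small
   order al with integrable weight W(x) = prod_i (1 + |x_i|)^(-1-b), so the
   first part is at most a constant times
     (l(Q)/l(P))^al |lam_Q| |lam_P| (|Q| |P|)^(-1/2) W_Q(x) (W_P(x) + W_P(x_Q)).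
   AM-GM decouples lam_Q and lam_P, the cubes of one scale are disjoint so that
   summing W over them is comparable to integrating W, and the scales contribute
   a geometric series. *)

(** * Tonelli, affine changes of variables and product integrands on R^n *)

Section lebesgue_rV_integral.
Context {R : realType}.
Implicit Type n : nat.

(** By construction the measure in dimension [n.+1] is the image of a product measure under
    [cons_rV], so this is Tonelli's theorem. *)
Lemma ge0_integral_lebesgue_rVS n (h : 'rV[R]_n.+1 -> \bar R) :
  measurable_fun [set: 'rV[R]_n.+1] h -> (forall x, 0 <= h x)%E ->
  (\int[lebesgue_rV n.+1]_x h x =
   \int[lebesgue_measure]_t \int[lebesgue_rV n]_v h (cons_rV (t, v)))%E.
Proof.
move=> mh h0.
transitivity (\int[pushforward (@lebesgue_measure R \x lebesgue_rV n)%E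
   (@cons_rV R n)]_x h x)%E.
  by [].
rewrite ge0_integral_pushforward//; last exact: measurable_cons_rV.
rewrite preimage_setT fubini_tonelli1//; last by move=> x; exact: h0.
by apply: (measurableT_comp mh); exact: measurable_cons_rV.
Qed.

(** Lebesgue measure is determined by its values on half-open intervals, and there it agrees with
    the rescaled image measure under [phi]. *)
Lemma ge0_integral_affine (a l : R) (h : R -> \bar R) : 0 < l ->
  measurable_fun setT h -> (forall x, 0 <= h x)%E ->
  (\int[@lebesgue_measure R]_t h ((t - a) / l)%R =
   l%:E * \int[@lebesgue_measure R]_t h t)%E.
Proof.
move=> l0 mh h0.
pose phi (t : measurableTypeR R) : measurableTypeR R := (t - a) / l.
have mphi : measurable_fun setT phi.
  by apply: measurable_funM => //; exact: measurable_funB.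
have lV0 : 0 <= l^-1 by rewrite invr_ge0 ltW.
have muE A : measurable A -> @lebesgue_measure R A =
    mscale (NngNum lV0) (pushforward (@lebesgue_measure R) phi) A.
  apply: lebesgue_measure_unique => _ [[b c]] _ <-.
  transitivity ((l^-1)%:E * @lebesgue_measure R (phi @^-1` `]b, c]))%E;
    last by [].
  rewrite (_ : phi @^-1` _ = `]b * l + a, c * l + a]%classic); last first.
    apply/seteqP; split => x; rewrite /phi/= !in_itv/=;
    by rewrite ltr_pdivlMr// ler_pdivrMr// ltrBrDr lerBlDr.
  rewrite !lebesgue_measure_itv/= !lte_fin ltrD2r ltr_pM2r//.
  case: ifPn => _; last by rewrite mule0.
  rewrite -!EFinB -EFinM; congr EFin; field.
  by rewrite gt_eqF.
transitivity (\int[pushforward (@lebesgue_measure R) phi]_t h t)%E.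
  by rewrite ge0_integral_pushforward.
have -> : (\int[@lebesgue_measure R]_t h t = (l^-1)%:E *
    \int[pushforward (@lebesgue_measure R) phi]_t h t)%E.
  rewrite -(ge0_integral_mscale _ _ (NngNum lV0))//.
  by apply: eq_measure_integral => A mA _; exact: muE.
by rewrite muleA -EFinM divff ?mul1e// gt_eqF.
Qed.

Lemma measurable_rV_affine n (c : 'rV[R]_n) (l : R) :
  measurable_fun [set: 'rV[R]_n] (fun x : 'rV[R]_n => l *: (x - c)).
Proof.
apply: measurable_fun_rV => i; under eq_fun do rewrite !mxE.
apply: measurable_funM => //; apply: measurable_funB => //.
exact: measurable_coord.
Qed.

(** Induction on the dimension: the affine map acts on each coordinate separately, so Tonelli peels
    off one coordinate at a time, each contributing a factor [l]. *)
Lemma ge0_integral_rV_affine n (c : 'rV[R]_n) (l : R) (h : 'rV[R]_n -> \bar R) :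
  0 < l -> measurable_fun [set: 'rV[R]_n] h -> (forall x, 0 <= h x)%E ->
  (\int[lebesgue_rV n]_x h (l^-1 *: (x - c))%R =
   (l ^+ n)%:E * \int[lebesgue_rV n]_x h x)%E.
Proof.
move=> l0; elim: n => [|n IHn] in c h * => mh h0.
  rewrite expr0 mul1e; apply: eq_integral => x _.
  by rewrite [x]thinmx0 [_ *: _]thinmx0.
have mha := measurableT_comp mh (measurable_rV_affine c l^-1).
rewrite !ge0_integral_lebesgue_rVS//.
have consE t v : l^-1 *: (cons_rV (t, v) - c) =
    cons_rV ((t - c ord0 ord0) / l, l^-1 *: (v - (uncons_rV c).2)).
  have affE (x : 'rV[R]_n.+1) i :
      (l^-1 *: (x - c)) ord0 i = l^-1 * (x ord0 i - c ord0 i) by rewrite !mxE.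
  apply/rowP => i; rewrite affE; case: (unliftP ord0 i) => [j|] ->.
    by rewrite !cons_rVS/= !mxE.
  by rewrite !cons_rV0/= mulrC.
pose G (s : R) := (\int[lebesgue_rV n]_v h (cons_rV (s, v)))%E.
have mhc : measurable_fun setT (h \o @cons_rV R n).
  by apply: (measurableT_comp mh); exact: measurable_cons_rV.
have mG : measurable_fun setT (G : measurableTypeR R -> \bar R).
  have mF := @measurable_fun_fubini_tonelli_F _ _ (measurableTypeR R) 'rV[R]_n R
    (lebesgue_rV n) _ mhc (fun x => h0 _).
  exact: mF.
have G0 s : (0 <= G s)%E by exact: integral_ge0.
transitivity (\int[@lebesgue_measure R]_t
    ((l ^+ n)%:E * G ((t - c ord0 ord0) / l)%R))%E.
  apply: eq_integral => t _; under eq_integral do rewrite consE.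
  rewrite (IHn _ (fun v => h (cons_rV ((t - c ord0 ord0) / l, v))))//.
  exact: (measurableT_comp mhc (measurable_pair1 _)).
have mGa : measurable_fun setT
    (fun t : measurableTypeR R => G ((t - c ord0 ord0) / l)).
  apply: (measurableT_comp mG).
  by apply: measurable_funM => //; exact: measurable_funB.
have ln0 : (0 <= (l ^+ n)%:E)%E by rewrite lee_fin exprn_ge0// ltW.
rewrite (ge0_integralZl _ measurableT mGa (fun t _ => G0 _) ln0).
by rewrite (ge0_integral_affine _ l0 mG G0) muleA -EFinM exprSr.
Qed.

Lemma integrable_rV_affine n (c : 'rV[R]_n) (l : R) (f : 'rV[R]_n -> R) :
  0 < l -> (lebesgue_rV n).-integrable setT (EFin \o f) ->
  (lebesgue_rV n).-integrable setT (fun x => (f (l^-1 *: (x - c)))%:E).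
Proof.
move=> l0 /integrableP[mf foo]; apply/integrableP; split.
  exact: (measurableT_comp mf (measurable_rV_affine _ _)).
rewrite (ge0_integral_rV_affine c (h := fun x => `|(f x)%:E|%E))//.
  by rewrite lte_mul_pinfty// lee_fin exprn_ge0// ltW.
exact: measurableT_comp.
Qed.

(** The nonnegative case applies to the positive and negative parts. This carries the cancellation
    of a function over to its rescaled copies. *)
Lemma integral_rV_affine n (c : 'rV[R]_n) (l : R) (f : 'rV[R]_n -> R) :
  0 < l -> (lebesgue_rV n).-integrable setT (EFin \o f) ->
  (\int[lebesgue_rV n]_x (f (l^-1 *: (x - c))%R)%:E =
   (l ^+ n)%:E * \int[lebesgue_rV n]_x (f x)%:E)%E.
Proof.
move=> l0 intf; have mf := measurable_int _ intf.
have P := ge0_integral_rV_affine c l0 (measurable_funepos mf) (funepos_ge0 _).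
have N := ge0_integral_rV_affine c l0 (measurable_funeneg mf) (funeneg_ge0 _).
transitivity (\int[lebesgue_rV n]_x (EFin \o f)^\+ (l^-1 *: (x - c))%R -
    \int[lebesgue_rV n]_x (EFin \o f)^\- (l^-1 *: (x - c))%R)%E.
  pose aff (x : 'rV[R]_n) := l^-1 *: (x - c).
  have := integralE (lebesgue_rV n) setT ((EFin \o f) \o aff).
  by rewrite funepos_comp funeneg_comp.
rewrite P N -muleBr; last first.
- apply: fin_num_adde_defl; rewrite fin_numN.
  exact: integrable_neg_fin_num.
- by [].
congr (_ * _)%E; apply/esym.
exact: (integralE _ _ (EFin \o f)).
Qed.

Lemma integral_rV_prod n (w : R -> R) (c : R) : measurable_fun setT w ->
  (forall t, 0 <= w t) -> (\int[lebesgue_measure]_t (w t)%:E = c%:E)%E ->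
  (\int[lebesgue_rV n]_x (\prod_(i < n) w (x ord0 i))%:E = (c ^+ n)%:E)%E.
Proof.
move=> mw w0 wc.
have mprod m : measurable_fun [set: 'rV[R]_m]
    (fun x : 'rV[R]_m => \prod_(i < m) w (x ord0 i)).
  apply: measurable_prod => i _.
  exact: (measurableT_comp mw (measurable_coord i)).
have mprodE m : measurable_fun [set: 'rV[R]_m]
    (fun x : 'rV[R]_m => (\prod_(i < m) w (x ord0 i))%:E).
  by apply/measurable_EFinP; exact: mprod.
have prod0 m (x : 'rV[R]_m) : (0 <= (\prod_(i < m) w (x ord0 i))%:E)%E.
  by rewrite lee_fin prodr_ge0.
have mwE : measurable_fun setT (fun t : measurableTypeR R => (w t)%:E).
  by apply/measurable_EFinP; exact: mw.
have wE0 t : (0 <= (w t)%:E)%E by rewrite lee_fin.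
elim: n => [|n IHn].
  rewrite expr0 /= (eq_integral (cst 1%E)); last first.
    by move=> x _; rewrite big_ord0.
  by rewrite integral_cst//= diracE mem_set// mule1.
rewrite (ge0_integral_lebesgue_rVS (mprodE _) (prod0 _)).
transitivity (\int[@lebesgue_measure R]_t ((c ^+ n)%:E * (w t)%:E))%E.
  apply: eq_integral => t _; rewrite -IHn muleC.
  rewrite -(ge0_integralZl _ measurableT (mprodE n)
    (fun x _ => prod0 n x) (wE0 t)).
  apply: eq_integral => v _; rewrite big_ord_recl cons_rV0/= EFinM.
  by under eq_bigr do rewrite cons_rVS.
have c0 : 0 <= c by rewrite -lee_fin -wc integral_ge0.
have cn0 : (0 <= (c ^+ n)%:E)%E by rewrite lee_fin exprn_ge0.
rewrite (ge0_integralZl _ measurableT mwE (fun t _ => wE0 t) cn0).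
by rewrite wc -EFinM exprSr.
Qed.

End lebesgue_rV_integral.

(** * The one-dimensional weight *)

Section decay1.
Context {R : realType}.
Implicit Type b t : R.

Definition decay1 b t : R := (1 + `|t|) `^ (- 1 - b).

Lemma onenormr_gt0 t : 0 < 1 + `|t|.
Proof. by rewrite ltr_pwDl. Qed.

Lemma decay1_gt0 b t : 0 < decay1 b t.
Proof. by rewrite powR_gt0// onenormr_gt0. Qed.

Lemma decay1N b t : decay1 b (- t) = decay1 b t.
Proof. by rewrite /decay1 normrN. Qed.

Lemma continuous_decay1 b : continuous (decay1 b).
Proof.
move=> t; apply: (@continuous_comp _ _ _ (fun t : R => 1 + `|t|)
    (fun u : R => u `^ (- 1 - b))).
  by apply: cvgD; [exact: cvg_cst|exact: norm_continuous].
apply: differentiable_continuous; apply/derivable1_diffP.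
by apply: ex_derive; apply: is_derive1_powR; exact: onenormr_gt0.
Qed.

Lemma powRN_cvgy b : 0 < b -> (1 + t) `^ (- b) @[t --> +oo] --> (0 : R).
Proof.
move=> b0; apply/cvgrPdist_lt => e e0; near=> t.
have t0 : 0 < t by near: t; exact: nbhs_pinfty_gt.
have et : e `^ (- b^-1) < t by near: t; exact: nbhs_pinfty_gt.
rewrite sub0r normrN ger0_norm ?powR_ge0// powRN invf_plt ?posrE//; last first.
  by rewrite powR_gt0// ltr_wpDl.
have -> : e^-1 = (e `^ (- b^-1)) `^ b.
  by rewrite -powRrM mulNr mulVf ?gt_eqF// powR_inv1// ltW.
apply: gt0_ltr_powR => //; rewrite ?nnegrE ?powR_ge0//.
  by rewrite addr_ge0// ltW.
by rewrite (lt_trans et)// ltrDr.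
Unshelve. all: by end_near. Qed.

Lemma integral_decay1 b : 0 < b ->
  (\int[lebesgue_measure]_t (decay1 b t)%:E = (2 / b)%:E)%E.
Proof.
(* The weight is even, so the half-line suffices. There [F] is an antiderivative that vanishes at
   infinity; working on t > -1 makes it differentiable at the endpoint 0 too. *)
move=> b0; pose F t : R := - b^-1 * (1 + t) `^ (- b).
have dF t : -1 < t -> is_derive t 1 F ((1 + t) `^ (- 1 - b)).
  move=> t1; have t0 : 0 < 1 + t by rewrite -ltrBlDl sub0r.
  have dt : is_derive t 1 (fun t : R => 1 + t) 1.
    rewrite (_ : (fun u : R => 1 + u) = shift 1); first exact: is_derive_shift.
    by apply/funext => u /=; rewrite addrC.
  have dp := is_derive1_powR (- b) t0.
  have dc := @is_derive1_comp R (fun u : R => u `^ (- b))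
    (fun t : R => 1 + t) t _ _ dp dt.
  have := is_deriveZ (- b^-1) dc.
  rewrite (_ : _ *: _ = (1 + t) `^ (- 1 - b)).
    exact.
  rewrite mulr1 /GRing.scale/= mulrA mulrNN mulVf ?gt_eqF// mul1r.
  by congr (_ `^ _); rewrite addrC.
rewrite ge0_symfun_integralT; last 3 first.
- by move=> t; exact/ltW/decay1_gt0.
- exact: continuous_decay1.
- by move=> t /=; rewrite decay1N.
rewrite -set_itvcy (@ge0_continuous_FTC2y _ _ F 0 0).
- rewrite sub0e /F addr0 powR1 mulr1 EFinN oppeK -EFinM.
  by [].
- by move=> t _; exact/ltW/decay1_gt0.
- by apply: continuous_subspaceT => t; exact: continuous_decay1.
- rewrite -[X in _ --> X](mulr0 (- b^-1)).
  by apply: cvgMr; exact: powRN_cvgy.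
- by move=> t t0; apply: ex_derive; apply: dF; rewrite (lt_trans _ t0)// ltrN10.
- apply: cvg_at_right_filter; apply: differentiable_continuous.
  by apply/derivable1_diffP; apply: ex_derive; apply: dF; rewrite ltrN10.
- move=> t; rewrite in_itv/= andbT => t0.
  rewrite derive1E.
  have [_ ->] : is_derive t 1 F ((1 + t) `^ (- 1 - b)).
    by apply: dF; rewrite (lt_trans _ t0)// ltrN10.
  by rewrite /decay1 gtr0_norm.
Qed.

(** The triangle inequality gives 1 + |t| <= 2 (1 + |s|), so the weight changes by a bounded factor
    over unit distances. *)
Lemma decay1_near b s t : 0 <= b -> `|s - t| <= 1 ->
  decay1 b s <= 2 `^ (1 + b) * decay1 b t.
Proof.
move=> b0 st1.
have b1 : 0 <= 1 + b by rewrite addr_ge0.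
rewrite /decay1 -!opprD !powRN ler_pdivlMr ?powR_gt0 ?onenormr_gt0//.
rewrite mulrC ler_pdivrMr ?powR_gt0 ?onenormr_gt0// -powRM ?addr_ge0//.
apply: ge0_ler_powR => //; rewrite ?nnegrE ?mulr_ge0 ?addr_ge0//.
have : `|t| <= `|s| + `|s - t|.
  by rewrite -[X in `|X|](subKr s) (le_trans (ler_normB _ _)).
move: (normr_ge0 s); lra.
Qed.

End decay1.

(** * Dyadic cubes of one scale, and measurability of continuous functions *)

Section dyadic_cubes.
Context {R : realType} (d : nat).
Implicit Types (Q : dyadic d) (x y : 'rV[R]_d).

Lemma measurable_dyadic_cube Q : measurable (@dyadic_cube d R Q).
Proof.
rewrite (_ : @dyadic_cube d R Q = \bigcap_i [set x : 'rV[R]_d | x ord0 i \in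
    `[(Q.2 ord0 i)%:~R * side R Q, ((Q.2 ord0 i)%:~R + 1) * side R Q[]); last first.
  by apply/seteqP; split => [x Bx i _|x Bx i]; exact: Bx.
apply: fin_bigcap_measurable => // i _.
rewrite -[X in measurable X]setTI.
exact: (measurable_coord i measurableT (measurable_itv _)).
Qed.

(** A cube is determined by its scale and any one of its points; this makes the cubes of one scale
    disjoint. *)
Lemma dyadic_cube_floor Q x : @dyadic_cube d R Q x ->
  forall i, Num.floor (x ord0 i / side R Q) = Q.2 ord0 i.
Proof.
move=> Qx i; apply: floor_def; rewrite ler_pdivlMr ?side_gt0//.
by rewrite ltr_pdivrMr ?side_gt0// intrD; exact: Qx.
Qed.

Lemma mem_dyadic_cube x (k : int) :
  @dyadic_cube d R (k, \row_i Num.floor (x ord0 i / 2 ^ k)) x.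
Proof.
move=> i; rewrite /side mxE/=.
have k0 : (0 : R) < 2 ^ k by rewrite exprz_gt0.
rewrite -ler_pdivlMr// -ltr_pdivrMr// floor_le -(intrD _ _ 1).
exact: floorD1_gt.
Qed.

Lemma dyadic_cube_same_scale Q Q' x : Q.1 = Q'.1 ->
  @dyadic_cube d R Q x -> @dyadic_cube d R Q' x -> Q = Q'.
Proof.
case: Q Q' => [k u] [k' u'] /= <-{k'} /dyadic_cube_floor xu /dyadic_cube_floor xu'.
by congr pair; apply/rowP => i; rewrite -(xu i) -(xu' i).
Qed.

Lemma dyadic_cube_center_dist Q y : @dyadic_cube d R Q y ->
  forall i, `|center_of R Q ord0 i - y ord0 i| <= side R Q.
Proof.
move=> Qy i; have /andP[] := Qy i; rewrite mxE ler_norml.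
have := side_gt0 R Q; rewrite !mulrDl => s0 y1 y2; apply/andP; split; lra.
Qed.

(** The sigma-algebra is generated by the coordinates; an open set is recovered as the countable
    union of the dyadic cubes that it contains. *)
Lemma open_measurable_rV (U : set 'rV[R]_d) : open U -> measurable U.
Proof.
move=> oU; rewrite (_ : U = \bigcup_(Q : dyadic d)
    (if `[< @dyadic_cube d R Q `<=` U >] then @dyadic_cube d R Q else set0)).
  apply: countable_bigcupT_measurable => [|Q]; first exact: countableP.
  by case: ifP => // _; exact: measurable_dyadic_cube.
apply/seteqP; split => [x Ux|x [Q _]]; last by case: asboolP => // QU; exact: QU.
have /nbhs_ballP[e /= e0 eU] := open_nbhs_nbhs (conj oU Ux).
(* A cube of side below [e] containing [x] lies in the sup-norm ball of radius [e] about [x]. Any n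
   > 1/e works, because 2^n > n. *)
have [n ne] : exists n, (2 : R) ^- n < e.
  exists (Num.bound e^-1).
  rewrite invf_plt ?posrE ?exprn_gt0//.
  rewrite (lt_le_trans (archi_boundP _)) ?invr_ge0 ?(ltW e0)//.
  by rewrite -natrX ler_nat ltnW// ltn_expl.
pose Q := (- n%:Z, \row_i Num.floor (x ord0 i / 2 ^ (- n%:Z))) : dyadic d.
have Qx : @dyadic_cube d R Q x by exact: mem_dyadic_cube.
suff QU : @dyadic_cube d R Q `<=` U by exists Q => //; rewrite asboolT.
move=> y Qy; apply: eU; split => // i j; rewrite ord1 /ball/=.
have /andP[x1 x2] := Qx j; have /andP[y1 y2] := Qy j.
have sE : side R Q < e by rewrite /side/= -exprnN.
move: x2 y2; rewrite !mulrDl mul1r => x2 y2.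
by rewrite ltr_norml; apply/andP; split; lra.
Qed.

Lemma continuous_measurable_fun_rV (f : 'rV[R]_d -> R) :
  continuous f -> measurable_fun [set: 'rV[R]_d] f.
Proof.
move=> /continuousP cf; apply: (measurability _ (RGenOpens.measurableE R)).
move=> _ [_ [a [b ->] <-]]; rewrite setTI; apply: open_measurable_rV.
exact/cf/interval_open.
Qed.

End dyadic_cubes.

(** * The product weight and its sums over the cubes of one scale *)

Section decay.
Context {R : realType} (d : nat) (b : R).
Hypothesis b0 : 0 < b.
Implicit Types (Q : dyadic d) (x y : 'rV[R]_d).

(** A product of one-variable weights instead of a power of the norm, so that the integral factors
    over the coordinates. *)
Definition decay x : R := \prod_(i < d) decay1 b (x ord0 i).

Lemma decay_gt0 x : 0 < decay x.
Proof. by apply: prodr_gt0 => i _; exact: decay1_gt0. Qed.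

Lemma decayN x : decay (- x) = decay x.
Proof. by apply: eq_bigr => i _; rewrite mxE decay1N. Qed.

Lemma decay_near x y : (forall i, `|x ord0 i - y ord0 i| <= 1) ->
  decay x <= (2 `^ (1 + b)) ^+ d * decay y.
Proof.
move=> xy; rewrite -[X in _ ^+ X]card_ord -prodr_const -big_split/=.
apply: ler_prod => i _; rewrite ltW ?decay1_gt0//=.
by rewrite decay1_near// ltW.
Qed.

Lemma measurable_decay : measurable_fun [set: 'rV[R]_d] decay.
Proof.
apply: measurable_prod => i _; apply: measurableT_comp.
  by apply: continuous_measurable_fun; exact: continuous_decay1.
exact: measurable_coord.
Qed.

Lemma integral_decay : (\int[lebesgue_rV d]_x (decay x)%:E = ((2 / b) ^+ d)%:E)%E.
Proof.
apply: integral_rV_prod.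
- by apply: continuous_measurable_fun; exact: continuous_decay1.
- by move=> t; exact/ltW/decay1_gt0.
- exact: integral_decay1.
Qed.

Lemma integral_decay_affine (a : 'rV[R]_d) (l : R) : 0 < l ->
  (\int[lebesgue_rV d]_x (decay (l^-1 *: (x - a))%R)%:E =
   (l ^+ d * (2 / b) ^+ d)%:E)%E.
Proof.
move=> l0; rewrite (ge0_integral_rV_affine a (h := EFin \o decay))//.
- by rewrite integral_decay.
- by apply/measurable_EFinP; exact: measurable_decay.
- by move=> x; rewrite lee_fin ltW// decay_gt0.
Qed.

Lemma integrable_decay : (lebesgue_rV d).-integrable setT (EFin \o decay).
Proof.
apply/integrableP; split.
  by apply/measurable_EFinP; exact: measurable_decay.
rewrite (eq_integral (EFin \o decay)); last first.
  by move=> x _; rewrite /= ger0_norm// ltW// decay_gt0.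
by rewrite integral_decay ltry.
Qed.

(** The first factor bounds the variation of [decay] over unit distances, the second is its
    integral. *)
Definition cube_sum_const : R := (2 `^ (1 + b)) ^+ d * (2 / b) ^+ d.

(* The cubes of one scale are disjoint and the decay is essentially constant on
   each of them, so that the sum is dominated by an integral. *)
Lemma sum_volume_decay (S : seq (dyadic d)) (k : int) (a : 'rV[R]_d) (l : R) :
  uniq S -> {in S, forall Q, Q.1 = k} -> 2 ^ k <= l ->
  \sum_(Q <- S) volume R Q * decay (l^-1 *: (center_of R Q - a)) <=
    cube_sum_const * l ^+ d.
Proof.
move=> uS Sk kl.
have l0 : 0 < l by rewrite (lt_le_trans _ kl)// exprz_gt0.
pose D Q := decay (l^-1 *: (center_of R Q - a)).
pose s x := \sum_(Q <- S) D Q * \1_(@dyadic_cube d R Q) x.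
have D0 Q : 0 <= D Q by rewrite ltW// decay_gt0.
have sE x : s x <= (2 `^ (1 + b)) ^+ d * decay (l^-1 *: (x - a)).
  have [[Q0 [Q0S Q0x]]|nQ] := pselect (exists Q, Q \in S /\ @dyadic_cube d R Q x).
    rewrite /s (bigD1_seq Q0)//= big1_seq ?addr0; last first.
      move=> Q /andP[QQ0 QS]; rewrite indicE memNset ?mulr0// => Qx.
      move/eqP : QQ0; apply; apply: dyadic_cube_same_scale Qx Q0x.
      by rewrite !Sk.
    (* The side [2 ^ k] is at most [l], so after division by [l] the center and the point [x] of the
       cube are at sup distance at most 1. *)
    rewrite indicE mem_set// mulr1; apply: decay_near => i.
    rewrite !mxE -mulrBr opprB addrA subrK normrM gtr0_norm ?invr_gt0//.
    rewrite mulrC ler_pdivrMr// mul1r (le_trans _ kl)//.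
    by have := dyadic_cube_center_dist Q0x i; rewrite !mxE /side Sk.
  rewrite /s big1_seq ?mulr_ge0 ?exprn_ge0 ?powR_ge0 ?(ltW (decay_gt0 _))//.
  move=> Q /= QS; rewrite indicE memNset ?mulr0// => Qx; apply: nQ.
  by exists Q.
have msR Q : measurable_fun [set: 'rV[R]_d]
    (fun x => D Q * \1_(@dyadic_cube d R Q) x).
  apply: measurable_funM => //.
  by apply: measurable_indic; exact: measurable_dyadic_cube.
have ms Q : measurable_fun [set: 'rV[R]_d]
    (fun x => (D Q * \1_(@dyadic_cube d R Q) x)%:E).
  by apply/measurable_EFinP; exact: msR.
have s0 Q x : (0 <= (D Q * \1_(@dyadic_cube d R Q) x)%:E)%E.
  by rewrite lee_fin mulr_ge0.
rewrite -lee_fin.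
have -> : (\sum_(Q <- S) volume R Q * D Q)%:E =
    (\int[lebesgue_rV d]_x (s x)%:E)%E.
  under eq_integral do rewrite -sumEFin.
  rewrite (ge0_integral_sum _ measurableT ms (fun Q x _ => s0 Q x)).
  rewrite -sumEFin; apply: eq_bigr => Q _.
  rewrite (@integralZl_indic _ _ _ (lebesgue_rV d) _ measurableT
      (fun=> @dyadic_cube d R Q)).
  - rewrite integral_indic//; last exact: measurable_dyadic_cube.
    by rewrite setIT /= lebesgue_dyadic_cube -EFinM mulrC.
  - by rewrite ltNge D0.
  - exact: measurable_dyadic_cube.
have mda : measurable_fun [set: 'rV[R]_d]
    (fun x => (decay (l^-1 *: (x - a)))%:E).
  apply/measurable_EFinP; apply: (measurableT_comp measurable_decay).
  exact: measurable_rV_affine.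
have da0 x : (0 <= (decay (l^-1 *: (x - a)))%:E)%E.
  by rewrite lee_fin ltW// decay_gt0.
have K0 : (0 <= ((2 `^ (1 + b)) ^+ d)%:E)%E.
  by rewrite lee_fin exprn_ge0// powR_ge0.
have -> : (cube_sum_const * l ^+ d)%:E = (((2 `^ (1 + b)) ^+ d)%:E *
    \int[lebesgue_rV d]_x (decay (l^-1 *: (x - a))%R)%:E)%E.
  by rewrite integral_decay_affine// -EFinM /cube_sum_const mulrAC mulrA.
rewrite -(ge0_integralZl _ measurableT mda (fun x _ => da0 x) K0).
apply: ge0_le_integral => //.
- by move=> x _; rewrite lee_fin; apply: sumr_ge0 => Q _; rewrite mulr_ge0.
- apply/measurable_EFinP; exact: measurable_sum.
- exact: measurable_funeM.
- by move=> x _; rewrite -EFinM lee_fin.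
Qed.

End decay.

(** * Geometric sums over scales, and Schur's test for finite sums *)

Lemma sum_geometric_le (R : realFieldType) (rho : R) (N : nat) :
  0 <= rho < 1 -> \sum_(n < N) rho ^+ n <= (1 - rho)^-1.
Proof.
move=> /andP[r0 r1]; have r10 : 0 < 1 - rho by rewrite subr_gt0.
rewrite -[leRHS]mul1r ler_pdivlMr// mulrC -opprB mulNr -subrX1 opprB.
by rewrite gerBl exprn_ge0.
Qed.

(** Grouping the cubes by their distance n in scale from [k0] leaves at most the two scales k0 + n
    and k0 - n in each group, whence the 2; the rest is a geometric series. *)
Lemma sum_geometric_scales (R : realFieldType) (d : nat) (rho C : R)
    (S : seq (dyadic d)) (a : dyadic d -> R) (k0 : int) :
  0 <= rho < 1 -> (forall Q, 0 <= a Q) ->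
  (forall k : int, \sum_(Q <- S | Q.1 == k) a Q <= C) ->
  \sum_(Q <- S) rho ^+ `|Q.1 - k0|%N * a Q <= 2 / (1 - rho) * C.
Proof.
move=> rho01 a0 aC; have /andP[r0 r1] := rho01.
(* One more than the sum of all distances exceeds each of them, which gives a finite cutoff. *)
pose N := (\sum_(Q <- S) `|Q.1 - k0|%N).+1.
have QN Q : Q \in S -> (`|Q.1 - k0| < N)%N.
  by move=> QS; rewrite ltnS (big_rem Q)//= leq_addr.
have -> : \sum_(Q <- S) rho ^+ `|Q.1 - k0|%N * a Q =
    \sum_(n < N) rho ^+ n * \sum_(Q <- S | `|Q.1 - k0|%N == n) a Q.
  under [RHS]eq_bigr do rewrite mulr_sumr big_mkcond.
  rewrite exchange_big/=; apply: eq_big_seq => Q /QN QS.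
  rewrite (bigD1 (Ordinal QS))//= eqxx big1 ?addr0// => n nQ.
  case: eqP => // Qn; move/eqP : nQ; case; exact: val_inj.
have aC2 (n : nat) : \sum_(Q <- S | `|Q.1 - k0|%N == n) a Q <= 2 * C.
  rewrite mulr_natl mulr2n.
  apply: le_trans (lerD (aC (k0 + n%:Z)) (aC (k0 - n%:Z))).
  rewrite big_mkcond [in leRHS]big_mkcond [X in _ + X]big_mkcond -big_split/=.
  apply: ler_sum => Q _; case: ifP => [|_]; last first.
    by rewrite addr_ge0//; case: ifP.
  move=> /eqP <-; case: (lerP 0 (Q.1 - k0)) => Qk.
    by rewrite gez0_abs// subrKC eqxx lerDl; case: ifP.
  by rewrite ltz0_abs// opprK subrKC eqxx lerDr; case: ifP.
have C0 : 0 <= C by apply: le_trans (aC k0); exact: sumr_ge0.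
apply: (@le_trans _ _ (\sum_(n < N) rho ^+ n * (2 * C))).
  by apply: ler_sum => n _; rewrite ler_wpM2l ?exprn_ge0.
rewrite -mulr_suml [leRHS](_ : _ = (1 - rho)^-1 * (2 * C)); last by ring.
by rewrite ler_wpM2r ?mulr_ge0// sum_geometric_le.
Qed.

(** The weight is 2 when [Q] has the strictly smaller scale, 1 at equal scales and 0 otherwise: by
    symmetry of the product, a pair of different scales is charged to its smaller cube. *)
Lemma sqr_sum_scales (R : realFieldType) (d : nat) (S : seq (dyadic d))
    (v : dyadic d -> R) :
  (\sum_(Q <- S) v Q) ^+ 2 = \sum_(Q <- S) \sum_(P <- S)
    ((Q.1 <= P.1)%R%:R + (Q.1 < P.1)%R%:R) * (v Q * v P).
Proof.
rewrite expr2 big_distrlr/=.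
under [RHS]eq_bigr do under eq_bigr do rewrite mulrDl.
under [RHS]eq_bigr do rewrite big_split.
rewrite big_split/= [X in _ + X]exchange_big/= -big_split/=.
apply: eq_bigr => Q _; rewrite -big_split/=; apply: eq_bigr => P _.
rewrite [v P * _]mulrC -mulrDl leNgt.
by case: (P.1 < Q.1); rewrite ?addr0 ?add0r mul1r.
Qed.

(** Bookkeeping after AM-GM: the fourth term comes transposed, and exchanging its sums attributes it
    to [Q] like the others. *)
Lemma sum_split4_exchange (V : nmodType) (I : Type) (S : seq I)
    (e1 e2 e3 e4 : I -> I -> V) :
  \sum_(Q <- S) \sum_(P <- S)
    (e1 Q P + e2 Q P + (e3 Q P + e4 P Q)) =
  \sum_(Q <- S) (\sum_(P <- S) e1 Q P + \sum_(P <- S) e2 Q P +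
    (\sum_(P <- S) e3 Q P + \sum_(P <- S) e4 Q P)).
Proof.
under eq_bigr do rewrite big_split/= big_split/= big_split/=.
rewrite big_split/= big_split/= big_split/= [X in _ + (_ + X)]exchange_big/=.
by rewrite -!big_split.
Qed.

(* Splitting [v P] as [v P - c Q P] plus the constant [c Q P] when [Q] is the
   smaller cube leaves a remainder that is linear in [v]; the first part is
   treated by Schur's test, in the form of AM-GM for [p Q * p P]. *)
Lemma sqr_sum_le_schur (R : realFieldType) (d : nat) (S : seq (dyadic d))
    (B L : R) (v p W : dyadic d -> R) (r c Z : dyadic d -> dyadic d -> R) :
  0 <= B -> (forall Q, 0 <= p Q) ->
  (forall Q P, 0 <= r Q P) -> (forall Q P, r Q P = r P Q) ->
  (forall Q, 0 <= W Q) -> (forall Q P, 0 <= Z Q P) ->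
  (forall Q, \sum_(P <- S) r Q P * W P <= L) ->
  (forall Q, \sum_(P <- S) r Q P * Z Q P <= L) ->
  (forall Q P : dyadic d, Q.1 <= P.1 -> `|v Q| * `|v P - c Q P| <=
     B * r Q P * (p Q * p P) * (W Q * (W P + Z Q P))) ->
  (\sum_(Q <- S) v Q) ^+ 2 <=
  \sum_(Q <- S) (B * (3 * L * p Q ^+ 2 +
      \sum_(P <- S) (Q.1 <= P.1)%R%:R * r Q P * p P ^+ 2 * Z Q P) * W Q +
    (\sum_(P <- S) ((Q.1 <= P.1)%R%:R + (Q.1 < P.1)%R%:R) * c Q P) * v Q).
Proof.
move=> B0 p0 r0 rC W0 Z0 rW rZ osc.
rewrite sqr_sum_scales big_split/=.
pose th (Q P : dyadic d) : R := (Q.1 <= P.1)%R%:R + (Q.1 < P.1)%R%:R.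
have -> : \sum_(Q <- S) \sum_(P <- S) th Q P * (v Q * v P) =
    \sum_(Q <- S) \sum_(P <- S)
      th Q P * (v Q * (v P - c Q P)) +
    \sum_(Q <- S) (\sum_(P <- S) th Q P * c Q P) * v Q.
  rewrite -big_split/=; apply: eq_bigr => Q _.
  rewrite mulr_suml -big_split/=; apply: eq_bigr => P _.
  by rewrite /th; ring.
rewrite lerD2r.
pose e (Q P : dyadic d) := B * (Q.1 <= P.1)%R%:R * r Q P * (p Q ^+ 2 + p P ^+ 2) *
  (W Q * (W P + Z Q P)).
apply: (@le_trans _ _ (\sum_(Q <- S) \sum_(P <- S) e Q P)).
  apply: ler_sum => Q _; apply: ler_sum => P _; rewrite /th /e.
  have [QP|QP] := leP Q.1 P.1; last first.
    by rewrite (lt_gtF QP) addr0 !(mul0r, mulr0).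
  have WZ0 : 0 <= W Q * (W P + Z Q P).
    by rewrite mulr_ge0// addr_ge0.
  have := osc _ _ QP; rewrite -normrM mulr1 => uQP.
  (* AM-GM; its factor 2 absorbs the multiplicity [th Q P], which is at most 2. *)
  have pp : p Q * p P * 2 <= p Q ^+ 2 + p P ^+ 2.
    rewrite -subr_ge0 [leRHS](_ : _ = (p Q - p P) ^+ 2) ?sqr_ge0//; ring.
  apply: (@le_trans _ _ (2 * `|v Q * (v P - c Q P)|)).
    apply: (le_trans (ler_norm _)); rewrite normrM ler_wpM2r//.
    by rewrite ger0_norm ?addr_ge0//; case: (_ < _); rewrite ?addr0 ?ler1n.
  apply: (@le_trans _ _ (2 * (B * r Q P * (p Q * p P) *
      (W Q * (W P + Z Q P))))).
    by rewrite ler_wpM2l.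
  rewrite mulrA ler_wpM2r// mulrCA ler_wpM2l ?mulr_ge0//.
  by rewrite mulrC.
rewrite /e.
(* Expansion of [e] into four terms. By symmetry of [r], the one with [p P ^+ 2] and [W P] is
   [e1 P Q]; after transposition three terms carry [p Q ^+ 2] and give [3 * L], and only [e3] keeps
   the coefficient of the larger cube. *)
pose e1 Q P := B * p Q ^+ 2 * W Q * (r Q P * W P).
pose e2 Q P := B * p Q ^+ 2 * W Q * (r Q P * Z Q P).
pose e3 (Q P : dyadic d) := B * W Q * ((Q.1 <= P.1)%R%:R * r Q P * p P ^+ 2 *
  Z Q P).
apply: (@le_trans _ _ (\sum_(Q <- S) \sum_(P <- S)
    (e1 Q P + e2 Q P + (e3 Q P + e1 P Q)))).
  apply: ler_sum => Q _; apply: ler_sum => P _; rewrite /e1 /e2 /e3 (rC P Q).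
  case: (Q.1 <= P.1); last first.
    rewrite [leLHS](_ : _ = 0); last by rewrite mulr0 !mul0r.
    have pW Q' : 0 <= B * p Q' ^+ 2 by rewrite mulr_ge0// exprn_ge0.
    by rewrite !addr_ge0// !mulr_ge0// exprn_ge0.
  rewrite /= mulr1 mul1r.
  rewrite le_eqVlt; apply/orP; left; apply/eqP; ring.
rewrite sum_split4_exchange; apply: ler_sum => Q _.
rewrite /e1 /e2 /e3 -!mulr_sumr.
set T := \sum_(P <- S) _ * p P ^+ 2 * Z Q P.
have BW : 0 <= B * p Q ^+ 2 * W Q by rewrite !mulr_ge0// exprn_ge0.
have h1 := ler_wpM2l BW (rW Q).
have h2 := ler_wpM2l BW (rZ Q).
rewrite [leRHS](_ : _ = B * p Q ^+ 2 * W Q * L +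
    B * p Q ^+ 2 * W Q * L +
    (B * W Q * T + B * p Q ^+ 2 * W Q * L)); last by ring.
by rewrite lerD ?lerD// lerD2l.
Qed.

(** * Almost orthogonality in integrated form for a real family with cancellation *)

Section almost_orthogonality.
Context {R : realType} (d : nat) (b rho : R).
Hypotheses (b0 : 0 < b) (rho01 : 0 <= rho < 1).
Implicit Types (P Q : dyadic d) (x : 'rV[R]_d) (S : seq (dyadic d)).

Definition cube_decay Q x : R := decay b ((side R Q)^-1 *: (x - center_of R Q)).

Lemma cube_decay_gt0 Q x : 0 < cube_decay Q x.
Proof. exact: decay_gt0. Qed.

Let K : R := cube_sum_const d b.
Let G : R := 2 / (1 - rho).

Let K0 : 0 <= K.
Proof.
by rewrite mulr_ge0// exprn_ge0 ?powR_ge0// divr_ge0// ltW.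
Qed.

Let G0 : 0 <= G.
Proof.
by case/andP: rho01 => _ ?; rewrite divr_ge0// subr_ge0 ltW.
Qed.

Lemma volume_gt0 Q : 0 < volume R Q.
Proof. by rewrite exprn_gt0// side_gt0. Qed.

(** At one scale the volumes are equal and cancel. Evenness of [decay] exchanges the roles of [x]
    and the centers, so [sum_volume_decay] applies with [l] equal to [2 ^ k]. *)
Lemma sum_cube_decay S (k : int) x : uniq S ->
  \sum_(Q <- S | Q.1 == k) cube_decay Q x <= K.
Proof.
move=> uS; rewrite -big_filter.
have k0 : (0 : R) < 2 ^ k by rewrite exprz_gt0.
rewrite -(ler_pM2r (exprn_gt0 d k0)).
have := @sum_volume_decay R d b b0 [seq Q <- S | Q.1 == k] k x (2 ^ k).
move=> /(_ (filter_uniq _ uS)) sumW; apply: le_trans (sumW _ _) => //.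
  rewrite mulr_suml le_eqVlt; apply/orP; left; apply/eqP.
  apply: eq_big_seq => Q; rewrite mem_filter => /andP[/eqP Qk _].
  by rewrite /cube_decay /volume /side Qk mulrC -decayN -scalerN opprB.
by move=> Q; rewrite mem_filter => /andP[/eqP].
Qed.

Lemma sum_volume_cube_decay S (k : int) P : uniq S -> k <= P.1 ->
  \sum_(Q <- S | Q.1 == k) volume R Q * cube_decay P (center_of R Q) <=
    K * volume R P.
Proof.
move=> uS kP; rewrite -big_filter.
apply: (@sum_volume_decay R d b b0 _ k (center_of R P) (side R P)).
- exact: filter_uniq.
- by move=> Q; rewrite mem_filter => /andP[/eqP].
- by rewrite /side ler_weXz2l// ler1n.
Qed.

Lemma integral_cube_decay Q :
  (\int[lebesgue_rV d]_x (cube_decay Q x)%:E = (volume R Q * (2 / b) ^+ d)%:E)%E.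
Proof. by rewrite integral_decay_affine// side_gt0. Qed.

Lemma integrable_cube_decay Q :
  (lebesgue_rV d).-integrable setT (fun x => (cube_decay Q x)%:E).
Proof.
by apply: integrable_rV_affine; [exact: side_gt0|exact: integrable_decay].
Qed.

Variables (u : dyadic d -> 'rV[R]_d -> R) (p : dyadic d -> R) (B : R).
Hypotheses (B0 : 0 <= B) (p0 : forall Q, 0 <= p Q).
Hypothesis intu : forall Q, (lebesgue_rV d).-integrable setT (EFin \o u Q).
Hypothesis u0 : forall Q, (\int[lebesgue_rV d]_x (u Q x)%:E = 0)%E.
Hypothesis u_osc : forall Q P x, Q.1 <= P.1 ->
  `|u Q x| * `|u P x - u P (center_of R Q)| <=
  B * rho ^+ `|P.1 - Q.1|%N * (p Q * p P) *
    (cube_decay Q x * (cube_decay P x + cube_decay P (center_of R Q))).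

Let rate Q P : R := rho ^+ `|P.1 - Q.1|%N.

Let rate_ge0 Q P : 0 <= rate Q P.
Proof. by case/andP: rho01 => ? _; rewrite exprn_ge0. Qed.

Let rateC Q P : rate Q P = rate P Q.
Proof. by rewrite /rate distnC. Qed.

(** The AM-GM terms with the coefficient of the larger cube. They are controlled only after
    summation over [Q] against the volumes. *)
Let coarse S Q : R :=
  \sum_(P <- S) (Q.1 <= P.1)%R%:R * rate Q P * p P ^+ 2 *
    cube_decay P (center_of R Q).

Let kap S Q : R := B * (3 * (G * K) * p Q ^+ 2 + coarse S Q).

(** The constants split off from the larger cubes; they multiply [u Q], whose integral is 0. *)
Let lin S Q : R :=
  \sum_(P <- S) ((Q.1 <= P.1)%R%:R + (Q.1 < P.1)%R%:R) * u P (center_of R Q).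

Lemma sum_rate_cube_decay S Q x : uniq S ->
  \sum_(P <- S) rate Q P * cube_decay P x <= G * K.
Proof.
move=> uS; apply: sum_geometric_scales => //.
- by move=> P; rewrite ltW// cube_decay_gt0.
- by move=> k; exact: sum_cube_decay.
Qed.

(** Exchanging the sums fixes the larger cube [P]: the smaller cubes of one scale contribute at most
    [K * volume R P], and the scales form a geometric series. *)
Lemma sum_volume_coarse S : uniq S ->
  \sum_(Q <- S) volume R Q * coarse S Q <=
  G * K * \sum_(Q <- S) volume R Q * p Q ^+ 2.
Proof.
move=> uS; under eq_bigr do rewrite mulr_sumr.
rewrite exchange_big mulr_sumr/=; apply: ler_sum => P _.
pose a Q := (Q.1 <= P.1)%R%:R * (volume R Q * cube_decay P (center_of R Q)).
have a0 Q : 0 <= a Q.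
  by rewrite !mulr_ge0// ltW// ?volume_gt0// cube_decay_gt0.
rewrite (eq_bigr (fun Q => p P ^+ 2 * (rho ^+ `|Q.1 - P.1|%N * a Q))); last first.
  by move=> Q _; rewrite /a -[rho ^+ _]/(rate P Q) rateC; ring.
rewrite -mulr_sumr [leRHS]mulrA mulrC ler_wpM2r ?exprn_ge0 ?p0//.
rewrite -mulrA; apply: sum_geometric_scales => // k.
have [kP|kP] := leP k P.1.
  apply: le_trans (sum_volume_cube_decay uS kP).
  by apply: ler_sum => Q /eqP Qk; rewrite /a Qk kP mul1r.
rewrite big1 ?(mulr_ge0 K0 (ltW (volume_gt0 _)))//.
by move=> Q /eqP Qk; rewrite /a Qk leNgt kP mul0r.
Qed.

Lemma sqr_sum_le S x : uniq S ->
  (\sum_(Q <- S) u Q x) ^+ 2 <=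
  \sum_(Q <- S) (kap S Q * cube_decay Q x + lin S Q * u Q x).
Proof.
move=> uS; apply: (sqr_sum_le_schur B0 p0 rate_ge0 rateC (W := cube_decay^~ x)
    (Z := fun Q P => cube_decay P (center_of R Q))).
- by move=> Q; rewrite ltW// cube_decay_gt0.
- by move=> Q P; rewrite ltW// cube_decay_gt0.
- by move=> Q; exact: sum_rate_cube_decay.
- by move=> Q; exact: sum_rate_cube_decay.
- by move=> Q P; exact: u_osc.
Qed.

(** Integrating the pointwise bound removes the terms with [lin]. The 4 is the 3 visible in [kap]
    plus 1 from [coarse]. *)
Lemma integral_sqr_sum_le S : uniq S ->
  (\int[lebesgue_rV d]_x ((\sum_(Q <- S) u Q x) ^+ 2)%:E <=
   (B * (4 * (G * K)) * (2 / b) ^+ d * \sum_(Q <- S) volume R Q * p Q ^+ 2)%:E)%E.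
Proof.
move=> uS.
pose v Q x := kap S Q * cube_decay Q x + lin S Q * u Q x.
have intv1 Q : (lebesgue_rV d).-integrable setT
    (fun x => (kap S Q)%:E * (cube_decay Q x)%:E)%E.
  by apply: integrableZl => //; exact: integrable_cube_decay.
have intv2 Q : (lebesgue_rV d).-integrable setT
    (fun x => (lin S Q)%:E * (u Q x)%:E)%E.
  by apply: integrableZl => //; exact: intu.
have intv Q : (lebesgue_rV d).-integrable setT (fun x => (v Q x)%:E).
  rewrite (_ : (fun x => _) = (fun x => (kap S Q)%:E * (cube_decay Q x)%:E)%E \+
     (fun x => (lin S Q)%:E * (u Q x)%:E)%E)%E.
    exact: integrableD.
  by apply/funext => x; rewrite /v EFinD !EFinM.
have Iv Q : (\int[lebesgue_rV d]_x (v Q x)%:E =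
    (kap S Q * (volume R Q * (2 / b) ^+ d))%:E)%E.
  under eq_integral do rewrite /v EFinD !EFinM.
  rewrite (integralD measurableT (intv1 Q) (intv2 Q)).
  rewrite (integralZl measurableT (integrable_cube_decay Q)).
  rewrite (integralZl measurableT (intu Q)) u0 mule0 adde0.
  by rewrite integral_cube_decay -EFinM.
apply: (@le_trans _ _ (\int[lebesgue_rV d]_x (\sum_(Q <- S) (v Q x)%:E))%E).
  apply: ge0_le_integral => //.
  - by move=> x _; rewrite lee_fin sqr_ge0.
  - apply/measurable_EFinP; apply: measurable_funX; apply: measurable_sum => Q.
    by apply/measurable_EFinP; exact: measurable_int (intu Q).
  - by apply: emeasurable_sum => Q; exact: measurable_int (intv Q).
  - by move=> x _; rewrite sumEFin lee_fin; exact: sqr_sum_le.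
rewrite (integral_sum measurableT intv).
rewrite (eq_bigr _ (fun Q _ => Iv Q)) sumEFin lee_fin.
have c0 : 0 <= (2 / b) ^+ d by rewrite exprn_ge0// divr_ge0// ltW.
under eq_bigr do rewrite mulrA.
rewrite -mulr_suml mulrAC ler_wpM2r// /kap.
rewrite (eq_bigr (fun Q => B * (3 * (G * K) * (volume R Q * p Q ^+ 2) +
    volume R Q * coarse S Q))); last by move=> Q _; ring.
rewrite -mulr_sumr -[leRHS]mulrA ler_wpM2l// big_split/= -mulr_sumr.
rewrite [leRHS](_ : _ = 3 * (G * K) * (\sum_(Q <- S) volume R Q * p Q ^+ 2) +
    G * K * (\sum_(Q <- S) volume R Q * p Q ^+ 2)); last by ring.
by rewrite lerD2l; exact: sum_volume_coarse.
Qed.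

End almost_orthogonality.

(** * Comparison of the Euclidean norm, the sup norm and the product weight *)

Section sup_norm.
Context {R : realType} (d : nat).
Implicit Type x : 'rV[R]_d.

Lemma coord_le_norm x i : `|x ord0 i| <= `|x|.
Proof.
rewrite [leRHS]mx_normrE.
exact: (le_bigmax_cond _ (fun j => `|x j.1 j.2|) (j := (ord0, i))).
Qed.

Lemma norm_le_enorm x : `|x| <= enorm x.
Proof.
rewrite [leLHS]mx_normrE; apply/bigmax_leP; split => [|[j i] _].
  exact: sqrtr_ge0.
rewrite ord1 -sqrtr_sqr ler_wsqrtr// (bigD1 i)//= lerDl.
by apply: sumr_ge0 => k _; exact: sqr_ge0.
Qed.

Lemma enorm_le_norm x : enorm x <= d%:R * `|x|.
Proof.
rewrite -[leRHS]ger0_norm ?mulr_ge0// -sqrtr_sqr ler_wsqrtr//.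
apply: (@le_trans _ _ (\sum_(i < d) `|x| ^+ 2)).
  apply: ler_sum => i _; rewrite -[leLHS]real_normK ?num_real//.
  by rewrite lerXn2r ?nnegrE// coord_le_norm.
rewrite sumr_const card_ord -[leLHS]mulr_natl exprMn ler_wpM2r ?sqr_ge0//.
by rewrite -natrX ler_nat; case: (d) => // n; rewrite expnS expn1 leq_pmulr.
Qed.

(** Each coordinate is at most the sup norm, so each of the [d] factors of [decay] is at least (1 +
    |x|)^(-1-b). *)
Lemma powR_norm_le_decay b x : 0 < b ->
  (1 + `|x|) `^ (- d%:R - d%:R * b) <= decay b x.
Proof.
move=> b0; have -> : - d%:R - d%:R * b = (- 1 - b) * d%:R by ring.
rewrite powRrM powR_mulrn ?powR_ge0// -[X in _ ^+ X]card_ord -prodr_const.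
apply: ler_prod => i _; rewrite powR_ge0/= /decay1.
rewrite -opprD !powRN lef_pV2 ?posrE ?powR_gt0 ?ltr_pwDl//.
by rewrite ge0_ler_powR ?nnegrE ?addr_ge0 ?(ltW b0)// lerD2l coord_le_norm.
Qed.

End sup_norm.

(** * A mean value inequality seen through a real functional *)

Section mean_value.
Context {R : realType} (d : nat).
Variables (f : 'rV[R]_d -> Rcomplex R) (rho : {linear Rcomplex R -> R}).
Hypothesis rho_le : forall z, `|rho z| <= `|z|.
Hypothesis df : forall x, differentiable f x.

Lemma bounded_linear_continuous : continuous rho.
Proof.
move=> z A /nbhs_ballP[e e0 eA]; apply/nbhs_ballP; exists e => // w zw /=.
apply: eA; rewrite /ball/= -linearB (le_lt_trans (rho_le _))//.
Qed.

Lemma continuous_comp_linear : continuous (rho \o f).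
Proof.
move=> x; apply: continuous_comp; last exact: bounded_linear_continuous.
exact: differentiable_continuous.
Qed.

Lemma is_derive_line (y v : 'rV[R]_d) (t : R) :
  is_derive t 1 (fun s : R => rho (f (y + s *: v))) (rho ('D_v f (y + t *: v))).
Proof.
have : h^-1 *: (rho (f (y + (h *: 1 + t) *: v)) - rho (f (y + t *: v)))
    @[h --> (0 : R)^'] --> rho ('D_v f (y + t *: v)).
  have Df : derivable f (y + t *: v) v by exact: diff_derivable.
  have := @cvg_comp _ _ _ _ rho _ _ _ Df (@bounded_linear_continuous _).
  apply: cvg_trans; apply: near_eq_cvg; near=> h => /=.
  rewrite linearZ/= linearB/=.
  have -> : y + (h *: 1 + t) *: v = h *: v + (y + t *: v); last by [].
  by rewrite [h *: 1]mulr1 scalerDl addrCA.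
by move=> D; apply: DeriveDef; [exact: cvgP D|exact: cvg_lim D].
Unshelve. all: by end_near. Qed.

Lemma derive_le_grad_norm (v z : 'rV[R]_d) :
  `|'D_v f z| <= d%:R * `|v| * grad_norm f z.
Proof.
rewrite deriveE// {1}[v]row_sum_delta linear_sum.
apply: (le_trans (ler_norm_sum _ _ _)).
apply: (@le_trans _ _ (\sum_(i < d) `|v| * grad_norm f z)).
  apply: ler_sum => i _; rewrite linearZ/= normrZ ler_pM// ?coord_le_norm//.
  rewrite -deriveE// -/(partial f i z) -[leLHS]ger0_norm// -sqrtr_sqr.
  rewrite ler_wsqrtr// (bigD1 i)//= lerDl.
  by apply: sumr_ge0 => k _; exact: sqr_ge0.
by rewrite sumr_const card_ord -mulrA mulr_natl.
Qed.

(** The mean value theorem needs real values, hence the functional [rho]. It is used on the segment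
    from [y] to [x], whose points are within |x - y| of [y]. *)
Lemma mean_value_le (x y : 'rV[R]_d) (D : R) :
  (forall z, `|z - y| <= `|x - y| -> grad_norm f z <= D) ->
  `|rho (f x) - rho (f y)| <= d%:R * `|x - y| * D.
Proof.
move=> fD; pose phi s := rho (f (y + s *: (x - y))).
have dphi (s : R) : is_derive s 1 phi (rho ('D_(x - y) f (y + s *: (x - y)))).
  exact: is_derive_line.
have cphi : {within `[0, 1], continuous phi}.
  apply: continuous_subspaceT => s; apply: differentiable_continuous.
  by apply/derivable1_diffP; exact: (@ex_derive _ _ _ _ _ _ _ (dphi s)).
have [c] := @MVT R phi _ 0 1 ltr01 (fun s _ => dphi s) cphi.
rewrite in_itv/= => /andP[c0 c1].
rewrite /phi scale1r scale0r addr0 subrKC subr0 mulr1 => ->.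
rewrite (le_trans (rho_le _))// (le_trans (derive_le_grad_norm _ _))//.
rewrite ler_wpM2l ?mulr_ge0//; apply: fD.
rewrite addrAC subrr add0r normrZ gtr0_norm// ler_piMl// ltW//.
Qed.

End mean_value.

(** * Hoelder estimate by interpolation between decay and gradient bounds *)

Lemma le_powR_interpolate (R : realType) (al K a b t : R) :
  0 <= al <= 1 -> 0 <= K -> 0 <= a -> 0 <= b -> 0 <= t ->
  t <= K * a -> t <= K * b -> t <= K * (a `^ (1 - al) * b `^ al).
Proof.
move=> /andP[al0 al1] K0 a0 b0 t0 ta tb.
have al1' : 0 <= 1 - al by rewrite subr_ge0.
(* The two bounds on [t] are raised to the powers [1 - al] and [al] and multiplied. *)
have split1 (r : R) : 0 <= r -> r = r `^ (1 - al) * r `^ al.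
  by move=> r0; rewrite -powRD ?subrK ?powRr1// oner_eq0.
rewrite {1}(split1 t)// [X in X * (_ * _)](split1 K)// mulrACA -!powRM//.
by apply: ler_pM; rewrite ?powR_ge0// ge0_ler_powR ?nnegrE ?mulr_ge0.
Qed.

Section hoelder_continuity.
Context {R : realType} (d : nat) (eps C1 C2 M : R).
Hypotheses (d_gt0 : (0 < d)%N) (eps_gt0 : 0 < eps) (C1_gt0 : 0 < C1)
  (C2_gt0 : 0 < C2) (M_ge0 : 0 <= M).

(** Chosen so that interpolation with this exponent gives up exactly half of the extra decay
    [eps]. *)
Definition hoelder_exp : R := eps / 2 / (M + d%:R + eps).
(** Chosen so that [decay] dominates (1 + |x|)^(-d-eps/2). *)
Definition decay_exp : R := eps / (2 * d%:R).
(** The first summand serves the bound by size and the second the bound by the gradient, so the sum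
    serves both. *)
Definition hoelder_const : R :=
  C1 * (2 `^ (d%:R + eps) + 1) + d%:R * C2 * (2 * d%:R) `^ M.

Let b := decay_exp.
Let al := hoelder_exp.

Let dR : 1 <= d%:R :> R. Proof. by rewrite ler1n. Qed.

Let den_gt0 : 0 < M + d%:R + eps.
Proof. by rewrite ltr_wpDl// addr_ge0. Qed.

Lemma decay_exp_gt0 : 0 < decay_exp.
Proof. by rewrite divr_gt0// mulr_gt0// ltr0n. Qed.

Lemma hoelder_exp_gt0 : 0 < hoelder_exp.
Proof. by rewrite !divr_gt0. Qed.

Lemma hoelder_expE : hoelder_exp * (M + d%:R + eps) = eps / 2.
Proof. by rewrite /hoelder_exp divfK// gt_eqF. Qed.

Let al_eps : al <= eps / 2.
Proof.
rewrite /al /hoelder_exp ler_pdivrMr// ler_peMr ?divr_ge0 ?(ltW eps_gt0)//.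
by rewrite -addrA addrCA (le_trans dR)// lerDl addr_ge0// ltW.
Qed.

Let al1 : al <= 1.
Proof.
rewrite /al /hoelder_exp ler_pdivrMr// mul1r.
move: eps_gt0 dR M_ge0; lra.
Qed.

Let db : d%:R * b = eps / 2.
Proof.
rewrite /b /decay_exp; field.
by rewrite pnatr_eq0 -lt0n.
Qed.

Lemma hoelder_const_ge : C1 <= hoelder_const.
Proof.
rewrite /hoelder_const mulrDr mulr1 -addrA addrCA lerDl addr_ge0//.
  by rewrite mulr_ge0 ?powR_ge0// ltW.
by rewrite !mulr_ge0 ?powR_ge0// ltW.
Qed.

Let X1 (x : 'rV[R]_d) : 1 <= 1 + `|x|. Proof. by rewrite lerDl. Qed.
Let X0 (x : 'rV[R]_d) : 0 < 1 + `|x|. Proof. exact: lt_le_trans (X1 x). Qed.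

Lemma powR_decay_le (x : 'rV[R]_d) (r : R) : r <= - (d%:R + eps / 2) ->
  (1 + `|x|) `^ r <= decay b x.
Proof.
move=> rle; apply: le_trans (powR_norm_le_decay x decay_exp_gt0).
by apply: ler_powR => //; rewrite -/b db -opprD.
Qed.

Variable f : 'rV[R]_d -> Rcomplex R.
Hypothesis f_decay : forall x, `|f x| <= C1 * (1 + enorm x) `^ (- d%:R - eps).

Lemma f_le_powR x : `|f x| <= C1 * (1 + `|x|) `^ (- (d%:R + eps)).
Proof.
rewrite (le_trans (f_decay x))// ler_pM2l// -opprD !powRN.
have x1 : 0 < 1 + enorm x by rewrite ltr_pwDl// sqrtr_ge0.
rewrite lef_pV2 ?posrE ?powR_gt0//.
apply: ge0_ler_powR; rewrite ?nnegrE ?(ltW x1) ?(ltW (X0 x)) ?addr_ge0//.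
  exact: ltW.
by rewrite lerD2l norm_le_enorm.
Qed.

Lemma f_le_decay x : `|f x| <= C1 * decay b x.
Proof.
rewrite (le_trans (f_le_powR x))// ler_pM2l//; apply: powR_decay_le.
move: eps_gt0; lra.
Qed.

(** Since [al] is at most [eps / 2], enough decay survives the factor |x|^al. That factor appears
    when the Hoelder estimate for a larger cube is written in the coordinates of a smaller one. *)
Lemma f_mul_powR_le_decay x : `|f x| * `|x| `^ al <= C1 * decay b x.
Proof.
apply: (@le_trans _ _
    (C1 * (1 + `|x|) `^ (- (d%:R + eps)) * (1 + `|x|) `^ al)).
  apply: ler_pM; rewrite ?powR_ge0 ?f_le_powR//.
  apply: ge0_ler_powR; rewrite ?nnegrE ?(ltW hoelder_exp_gt0) ?(ltW (X0 x))//.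
  by rewrite lerDr.
rewrite -mulrA ler_pM2l// -powRD; last by rewrite (gt_eqF (X0 x)) implybT.
apply: powR_decay_le; move: al_eps; lra.
Qed.

Hypothesis df : forall x, differentiable f x.
Hypothesis f_grad : forall x, grad_norm f x <= C2 * (1 + enorm x) `^ M.

Variable rho : {linear Rcomplex R -> R}.
Hypothesis rho_le : forall z, `|rho z| <= `|z|.

Lemma hoelder_bound x y : `|rho (f x) - rho (f y)| <=
  hoelder_const * `|x - y| `^ al * (decay b x + decay b y).
Proof.
have Wx := ltW (decay_gt0 b x); have Wy := ltW (decay_gt0 b y).
have K0 : 0 <= hoelder_const by rewrite (le_trans _ hoelder_const_ge)// ltW.
have tri : `|rho (f x) - rho (f y)| <= `|f x| + `|f y|.
  by rewrite (le_trans (ler_normB _ _))// lerD.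
(* At distance at least 1 the power of |x - y| is at least 1, and decay alone suffices. *)
have [h1|h1] := leP 1 `|x - y|.
  rewrite (le_trans tri)//.
  apply: (@le_trans _ _ (C1 * (decay b x + decay b y))).
    by rewrite mulrDr lerD// f_le_decay.
  rewrite ler_wpM2r ?addr_ge0// (le_trans hoelder_const_ge)//.
  rewrite ler_peMr// -(powRr0 `|x - y|) ler_powR//.
  exact/ltW/hoelder_exp_gt0.
(* For closer points this lets both bounds to be interpolated be stated at [y]. *)
have yx : 1 + `|y| <= 2 * (1 + `|x|).
  have : `|y| <= `|x| + `|x - y|.
    by rewrite -[X in `|X|](subKr x) (le_trans (ler_normB _ _)).
  move: (normr_ge0 x); lra.
have bd1 : `|rho (f x) - rho (f y)| <=
    hoelder_const * (1 + `|y|) `^ (- (d%:R + eps)).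
  rewrite (le_trans tri)//.
  apply: (@le_trans _ _ (C1 * (2 `^ (d%:R + eps) + 1) *
      (1 + `|y|) `^ (- (d%:R + eps)))); last first.
    by rewrite ler_wpM2r ?powR_ge0// lerDl !mulr_ge0 ?powR_ge0// ltW.
  rewrite -mulrA mulrDl mul1r mulrDr lerD ?f_le_powR//.
  rewrite (le_trans (f_le_powR x))// ler_pM2l// !powRN.
  rewrite -lter_pdivrMl ?powR_gt0// -invfM -powRM ?(ltW (X0 _))//.
  rewrite lef_pV2 ?posrE ?powR_gt0 ?mulr_gt0//.
  by apply: ge0_ler_powR; rewrite ?nnegrE ?addr_ge0 ?mulr_ge0 ?(ltW eps_gt0)// ltW.
(* Points [z] within distance 1 of [y] satisfy 1 + enorm z <= 2 d (1 + |y|), which is the source of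
   (2 d)^M in the constant. *)
have bd2 : `|rho (f x) - rho (f y)| <=
    hoelder_const * ((1 + `|y|) `^ M * `|x - y|).
  apply: (@le_trans _ _
      (d%:R * `|x - y| * (C2 * ((2 * d%:R) `^ M * (1 + `|y|) `^ M)))).
    apply: mean_value_le => // z zy; rewrite (le_trans (f_grad z))// ler_pM2l//.
    rewrite -powRM ?mulr_ge0 ?(ltW (X0 _))//.
    apply: ge0_ler_powR => //; rewrite ?nnegrE ?mulr_ge0 ?addr_ge0 ?sqrtr_ge0//.
    have z1 : `|z| <= 1 + `|y|.
      rewrite -[z](subrK y) (le_trans (ler_normD _ _))// lerD2r.
      by rewrite (le_trans zy)// ltW.
    have := ler_wpM2l (ler0n R d) z1; have := ler_wpM2r (ltW (X0 y)) dR.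
    have := enorm_le_norm z; have := X1 y; rewrite mul1r; lra.
  rewrite [leLHS](_ : _ = d%:R * C2 * (2 * d%:R) `^ M *
      ((1 + `|y|) `^ M * `|x - y|)); last by ring.
  rewrite ler_wpM2r ?mulr_ge0 ?powR_ge0// lerDr.
  by rewrite mulr_ge0 ?addr_ge0 ?powR_ge0// ltW.
have al01 : 0 <= al <= 1 by rewrite al1 (ltW hoelder_exp_gt0).
have m0 : 0 <= (1 + `|y|) `^ M * `|x - y| by rewrite mulr_ge0 ?powR_ge0.
(* The resulting exponent of 1 + |y| is -(d + eps) + al (M + d + eps) = -(d + eps/2), which
   [decay b y] dominates. *)
have := le_powR_interpolate al01 K0 (powR_ge0 _ _) m0 (normr_ge0 _) bd1 bd2.
move/le_trans; apply.
rewrite -mulrA ler_wpM2l// powRM ?powR_ge0// -!powRrM mulrA mulrC.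
rewrite ler_wpM2l ?powR_ge0// -powRD; last by rewrite (gt_eqF (X0 y)) implybT.
rewrite (le_trans (powR_decay_le _ _)) ?lerDr//.
have := hoelder_expE; rewrite -/al; move: (al) => a; nra.
Qed.

End hoelder_continuity.

(** * Real and imaginary parts *)

Section Rcomplex_parts.
Context {R : realType}.
Implicit Types z w : Rcomplex R.

Lemma Rcomplex_norm_sqr z :
  `|z| ^+ 2 = complex.Re z ^+ 2 + complex.Im z ^+ 2.
Proof.
case: z => a b; rewrite [X in X ^+ 2]/Num.norm /= sqr_sqrtr//.
by rewrite addr_ge0// sqr_ge0.
Qed.

Lemma Re_le_norm z : `|complex.Re z| <= `|z|.
Proof.
rewrite -[leRHS]ger0_norm// -ler_sqr ?nnegrE// !real_normK ?num_real//.
by rewrite Rcomplex_norm_sqr lerDl sqr_ge0.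
Qed.

Lemma Im_le_norm z : `|complex.Im z| <= `|z|.
Proof.
rewrite -[leRHS]ger0_norm// -ler_sqr ?nnegrE// !real_normK ?num_real//.
by rewrite Rcomplex_norm_sqr lerDr sqr_ge0.
Qed.

Lemma norm_le_ReIm z : `|z| <= `|complex.Re z| + `|complex.Im z|.
Proof.
rewrite -ler_sqr ?nnegrE ?addr_ge0// Rcomplex_norm_sqr sqrrD.
rewrite !real_normK ?num_real//.
by rewrite addrAC lerDl mulrn_wge0// mulr_ge0.
Qed.

Lemma Rcomplex_normM z w : `|z * w : Rcomplex R| = `|z| * `|w|.
Proof. exact: Normc.normcM. Qed.

Lemma Rcomplex_mulrZ (a : R) z w : z * (a *: w) = a *: (z * w) :> Rcomplex R.
Proof.
case: z w => [x y] [x' y']; apply/eqP; rewrite eq_complex/=.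
by apply/andP; split; apply/eqP => /=; ring.
Qed.

Definition ReL : {linear Rcomplex R -> R} := @complex.Re R.
Definition ImL : {linear Rcomplex R -> R} := @complex.Im R.

(** As [rho] is only real-linear, a complex coefficient mixes the two parts of [z]. This form passes
    integrability and zero integral from the parts to the product. *)
Lemma linear_mulE (rho : {linear Rcomplex R -> R}) (l z : Rcomplex R) :
  rho (l * z) = rho l * complex.Re z +
    rho (l * (Complex 0 1 : Rcomplex R)) * complex.Im z.
Proof.
have -> : l * z = complex.Re z *: l +
    complex.Im z *: (l * (Complex 0 1 : Rcomplex R)) :> Rcomplex R.
  case: l z => [a b] [c e]; apply/eqP; rewrite eq_complex/=.
  by apply/andP; split; apply/eqP => /=; ring.
by rewrite linearD !linearZ/=; congr (_ + _); exact: mulrC.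
Qed.

End Rcomplex_parts.

(** * Cancellation and oscillation of the atoms, and the bound for one real functional of the sum *)

Section synthesis.
Context {R : realType} (d : nat) (eps C1 C2 M : R).
Hypotheses (d_gt0 : (0 < d)%N) (eps_gt0 : 0 < eps) (C1_gt0 : 0 < C1)
  (C2_gt0 : 0 < C2) (M_ge0 : 0 <= M).
Variable f : dyadic d -> 'rV[R]_d -> Rcomplex R.
Hypotheses (df : forall Q x, differentiable (f Q) x)
  (f_int : forall Q, cintegral (f Q) = 0)
  (f_decay : forall Q x, `|f Q x| <= C1 * (1 + enorm x) `^ (- d%:R - eps))
  (f_grad : forall Q x, grad_norm (f Q) x <= C2 * (1 + enorm x) `^ M).
Variable lam : dyadic d -> Rcomplex R.
Implicit Types (P Q : dyadic d) (x y : 'rV[R]_d).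

Let b := decay_exp d eps.
Let al := hoelder_exp d eps M.
Let rate : R := 2 `^ (- al).

(** The constant of [integral_sqr_sum_le], with [B] the product of the decay and Hoelder constants
    and with ratio [rate], the gain per dyadic scale. *)
Definition synthesis_const : R :=
  C1 * (2 * hoelder_const d eps C1 C2 M) *
  (4 * (2 / (1 - rate) * cube_sum_const d b)) * (2 / b) ^+ d.

Lemma norm_sub_le Q x y : `|f Q x - f Q y| <=
  2 * hoelder_const d eps C1 C2 M * `|x - y| `^ al * (decay b x + decay b y).
Proof.
rewrite (le_trans (norm_le_ReIm _))// -!mulrA mulr_natl mulr2n !mulrA.
have h := hoelder_bound d_gt0 eps_gt0 C1_gt0 C2_gt0 M_ge0
  (f_decay Q) (df Q) (f_grad Q).
apply: lerD.
  rewrite -[complex.Re _]/(ReL _) linearB; exact: (h ReL Re_le_norm).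
rewrite -[complex.Im _]/(ImL _) linearB; exact: (h ImL Im_le_norm).
Qed.

Section part.
Variable rho : {linear Rcomplex R -> R}.
Hypothesis rho_le : forall z, `|rho z| <= `|z|.

Lemma integrable_part Q :
  (lebesgue_rV d).-integrable setT (fun x => (rho (f Q x))%:E).
Proof.
have b0 : 0 < b by exact: decay_exp_gt0.
apply: (@le_integrable _ _ _ _ _ measurableT _
    (fun x : 'rV[R]_d => C1%:E * (decay b x)%:E)%E).
- apply/measurable_EFinP; apply: continuous_measurable_fun_rV.
  exact: (continuous_comp_linear rho_le (df Q)).
- move=> x _; rewrite -EFinM !abse_EFin lee_fin (le_trans (rho_le _))//.
  rewrite (le_trans (f_le_decay d_gt0 eps_gt0 C1_gt0 (f_decay Q) x))//.
  exact: ler_norm.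
- by apply: integrableZl => //; exact: integrable_decay.
Qed.

End part.

(** The integral inside [cintegral] is real-valued and defaults to 0 at infinity; integrability
    shows that the extended integral is finite, hence truly 0. *)
Lemma integral_Re Q : (\int[lebesgue_rV d]_x (complex.Re (f Q x))%:E = 0)%E.
Proof.
rewrite -[LHS]fineK; last first.
  by apply: integrable_fin_num => //; exact: (integrable_part Re_le_norm Q).
by have /(congr1 (@complex.Re R)) /= := f_int Q; rewrite /Rintegral => ->.
Qed.

Lemma integral_Im Q : (\int[lebesgue_rV d]_x (complex.Im (f Q x))%:E = 0)%E.
Proof.
rewrite -[LHS]fineK; last first.
  by apply: integrable_fin_num => //; exact: (integrable_part Im_le_norm Q).
by have /(congr1 (@complex.Im R)) /= := f_int Q; rewrite /Rintegral => ->.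
Qed.

Variable rho : {linear Rcomplex R -> R}.
Hypothesis rho_le : forall z, `|rho z| <= `|z|.

Let g Q x : R := rho (lam Q * f Q x).

Lemma integrable_mul_part Q :
  (lebesgue_rV d).-integrable setT (EFin \o g Q).
Proof.
rewrite (_ : _ \o _ = (fun x => (rho (lam Q))%:E * (complex.Re (f Q x))%:E)%E \+
    (fun x => (rho (lam Q * (Complex 0 1 : Rcomplex R)))%:E *
      (complex.Im (f Q x))%:E)%E)%E; last first.
  by apply/funext => x; rewrite /= /g linear_mulE EFinD !EFinM.
apply: integrableD => //; apply: integrableZl => //.
  exact: (integrable_part Re_le_norm Q).
exact: (integrable_part Im_le_norm Q).
Qed.

Lemma integral_mul_part Q : (\int[lebesgue_rV d]_x (g Q x)%:E = 0)%E.
Proof.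
under eq_integral do rewrite /g linear_mulE EFinD !EFinM.
have iR := integrable_part Re_le_norm Q.
have iI := integrable_part Im_le_norm Q.
rewrite integralD//; last 2 first.
- exact: integrableZl.
- exact: integrableZl.
rewrite (integralZl measurableT iR) (integralZl measurableT iI).
by rewrite integral_Re integral_Im !mule0 adde0.
Qed.

Let s Q : R := (Num.sqrt (volume R Q))^-1.
Let u Q x : R := rho (lam Q * atom (f Q) Q x).
(** With this normalisation [volume R Q * p Q ^+ 2] is the square of the modulus of [lam Q]. *)
Let p Q : R := `|lam Q| * s Q.

Let uE Q x : u Q x = s Q * g Q ((side R Q)^-1 *: (x - center_of R Q)).
Proof. by rewrite /u /atom Rcomplex_mulrZ linearZ. Qed.

Let s0 Q : 0 <= s Q. Proof. by rewrite invr_ge0 sqrtr_ge0. Qed.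

Lemma integrable_atom_part Q : (lebesgue_rV d).-integrable setT
  (EFin \o (fun x => rho (lam Q * atom (f Q) Q x))).
Proof.
rewrite (_ : _ \o _ = (fun x => (s Q)%:E *
    (g Q ((side R Q)^-1 *: (x - center_of R Q)))%:E)%E); last first.
  by apply/funext => x; rewrite /= -/(u Q x) uE EFinM.
apply: integrableZl => //; apply: integrable_rV_affine; first exact: side_gt0.
exact: integrable_mul_part.
Qed.

Lemma integral_atom_part Q :
  (\int[lebesgue_rV d]_x (rho (lam Q * atom (f Q) Q x))%:E = 0)%E.
Proof.
under eq_integral do rewrite -/(u _ _) uE EFinM.
rewrite integralZl//; last first.
  apply: integrable_rV_affine; first exact: side_gt0.
  exact: integrable_mul_part.
rewrite integral_rV_affine ?side_gt0//; last exact: integrable_mul_part.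
by rewrite integral_mul_part !mule0.
Qed.

Lemma integral_sqr_part (S : seq (dyadic d)) : uniq S ->
  (\int[lebesgue_rV d]_x ((\sum_(Q <- S) rho (lam Q * atom (f Q) Q x)) ^+ 2)%:E <=
    (synthesis_const * \sum_(Q <- S) `|lam Q| ^+ 2)%:E)%E.
Proof.
move=> uS.
have b0 : 0 < b by exact: decay_exp_gt0.
have al0 : 0 < al by exact: hoelder_exp_gt0.
have H0 : 0 <= hoelder_const d eps C1 C2 M.
  by rewrite (le_trans (ltW C1_gt0))// hoelder_const_ge// ltW.
have rate01 : 0 <= rate < 1.
  rewrite powR_ge0/= /rate powRN invf_lt1 ?powR_gt0//.
  have := @gt0_ltr_powR R al al0 1 2; rewrite powR1.
  by apply; rewrite ?nnegrE// ltr1n.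
have -> : \sum_(Q <- S) `|lam Q| ^+ 2 = \sum_(Q <- S) volume R Q * p Q ^+ 2.
  apply: eq_bigr => Q _; rewrite /p /s exprMn exprVn.
  rewrite sqr_sqrtr; last exact/ltW/volume_gt0.
  by rewrite mulrCA divff ?mulr1// gt_eqF// volume_gt0.
apply: (integral_sqr_sum_le b0 rate01 (u := u) (p := p)
  (B := C1 * (2 * hoelder_const d eps C1 C2 M))) => //.
- by rewrite !mulr_ge0// ltW.
- by move=> Q; rewrite mulr_ge0.
- exact: integrable_atom_part.
- exact: integral_atom_part.
move=> Q P x QP.
(* Coordinates in which [Q0] becomes the unit cube centered at the origin. *)
pose xi Q0 y := (side R Q0)^-1 *: (y - center_of R Q0).
have uQ : `|u Q x| <= p Q * `|f Q (xi Q x)|.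
  rewrite uE normrM (ger0_norm (s0 _)) /p -mulrA mulrCA ler_wpM2l//.
  by rewrite (le_trans (rho_le _))// Rcomplex_normM.
have uP : `|u P x - u P (center_of R Q)| <=
    p P * `|f P (xi P x) - f P (xi P (center_of R Q))|.
  rewrite !uE -mulrBr normrM (ger0_norm (s0 _)) /p -mulrA mulrCA ler_wpM2l//.
  by rewrite /g -linearB -mulrBr (le_trans (rho_le _))// Rcomplex_normM.
(* The difference is l(Q)/l(P) times [xi Q x], and this ratio to the power [al] is [rate] to the
   number of scales between the cubes. *)
have xiE : `|xi P x - xi P (center_of R Q)| `^ al =
    rate ^+ `|P.1 - Q.1|%N * `|xi Q x| `^ al.
  have xiQ : side R Q *: xi Q x = x - center_of R Q.
    by rewrite /xi scalerA divff ?scale1r// gt_eqF// side_gt0.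
  have -> : xi P x - xi P (center_of R Q) =
      (side R P)^-1 *: (side R Q *: xi Q x).
    by rewrite xiQ /xi -scalerBr opprB addrA subrK.
  have -> : rate ^+ `|P.1 - Q.1| = ((side R P)^-1 * side R Q) `^ al.
    rewrite /side -[in X in (X^-1)](subrKC Q.1 P.1).
    have -> : P.1 - Q.1 = `|P.1 - Q.1|%N%:Z by rewrite gez0_abs// subr_ge0.
    rewrite absz_nat expfzDr ?pnatr_eq0// invfM mulrAC mulVf; last first.
      by rewrite gt_eqF// exprz_gt0.
    rewrite mul1r; move: (absz _) => n.
    have -> : (2 ^ n%:Z)^-1 = 2 `^ (- n%:R) :> R by rewrite powR_invn.
    rewrite -powRrM /rate -powR_mulrn ?powR_ge0// -powRrM; congr (_ `^ _).
    by rewrite !mulNr mulrC.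
  rewrite scalerA normrZ gtr0_norm; last by rewrite mulr_gt0 ?invr_gt0 ?side_gt0.
  by rewrite powRM// mulr_ge0// ?invr_ge0 ltW// side_gt0.
apply: le_trans (ler_pM _ _ uQ uP) _ => //.
(* The decay of [f Q] pays for the power of [xi Q x] produced by the Hoelder estimate for [f P]. *)
have h1 := f_mul_powR_le_decay d_gt0 eps_gt0 C1_gt0 M_ge0 (f_decay Q) (xi Q x).
have h2 := norm_sub_le P (xi P x) (xi P (center_of R Q)).
rewrite xiE in h2.
have W0 : 0 <= decay b (xi P x) + decay b (xi P (center_of R Q)).
  by rewrite addr_ge0// ltW// decay_gt0.
rewrite [leLHS](_ : _ = p Q * p P * (`|f Q (xi Q x)| *
  `|f P (xi P x) - f P (xi P (center_of R Q))|)); last by ring.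
rewrite [leRHS](_ : _ = p Q * p P * (C1 * decay b (xi Q x) *
  (2 * hoelder_const d eps C1 C2 M * rate ^+ `|P.1 - Q.1| *
   (decay b (xi P x) + decay b (xi P (center_of R Q)))))); last first.
  rewrite /cube_decay -/(xi Q x) -/(xi P x) -/(xi P (center_of R Q)).
  move: (decay b (xi Q x)) (decay b (xi P x)) (decay b (xi P (center_of R Q))).
  move: (hoelder_const d eps C1 C2 M) (rate ^+ _) (p Q) (p P).
  by move=> H r q q' w w' w''; ring.
rewrite ler_wpM2l ?mulr_ge0//.
apply: (@le_trans _ _ (`|f Q (xi Q x)| * `|xi Q x| `^ al *
  (2 * hoelder_const d eps C1 C2 M * rate ^+ `|P.1 - Q.1| *
   (decay b (xi P x) + decay b (xi P (center_of R Q)))))).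
  rewrite -mulrA ler_wpM2l// (le_trans h2)// le_eqVlt; apply/orP; left.
  move: (decay b (xi P x) + _) (`|xi Q x| `^ al) (rate ^+ _) => w y r.
  move: (hoelder_const d eps C1 C2 M) => H.
  by apply/eqP; ring.
have r0 : 0 <= rate ^+ `|P.1 - Q.1|.
  by apply: exprn_ge0; case/andP: rate01.
exact: (ler_wpM2r (mulr_ge0 (mulr_ge0 (mulr_ge0 (ler0n R 2) H0) r0) W0) h1).
Qed.

End synthesis.

(** * The square-norm bound for finite sums of atoms *)

Theorem corollary1 (R : realType) (d : nat) (eps C1 C2 M : R)
    (d_gt0 : (0 < d)%N) (eps_gt0 : 0 < eps) (C1_gt0 : 0 < C1)
    (C2_gt0 : 0 < C2) (M_ge0 : 0 <= M) :
  exists A : R, forall f : dyadic d -> 'rV[R]_d -> Rcomplex R,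
    (forall Q x, differentiable (f Q) x) ->
    (forall Q, cintegral (f Q) = 0) ->
    (forall Q x, `|f Q x| <= C1 * (1 + enorm x) `^ (- d%:R - eps)) ->
    (forall Q x, grad_norm (f Q) x <= C2 * (1 + enorm x) `^ M) ->
    forall lam : dyadic d -> Rcomplex R,
      finite_set [set Q | lam Q != 0] ->
      (\int[lebesgue_rV d]_x
          (`|\sum_(Q \in [set: dyadic d]) lam Q * atom (f Q) Q x : Rcomplex R| ^+ 2)%:E
        <= (A * \sum_(Q \in [set: dyadic d]) `|lam Q| ^+ 2)%:E)%E.
Proof.
(* One copy of the constant for the real part of the sum and one for the imaginary part. *)
exists (2 * synthesis_const d eps C1 C2 M).
move=> f df f_int f_decay f_grad lam lamfin.
(* Both sums over all dyadic cubes reduce to this finite support. *)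
pose S := fset_set [set Q | lam Q != 0].
have lam0 Q : Q \notin S -> lam Q = 0.
  by rewrite in_fset_set// notin_setE/= => /negP; rewrite negbK => /eqP.
rewrite (@fsbigTE _ _ _ _ S); last by move=> Q /lam0 ->; rewrite normr0 expr0n.
pose F (rho : {linear Rcomplex R -> R}) x :=
  \sum_(Q <- S) rho (lam Q * atom (f Q) Q x).
have FE x :
    `|\sum_(Q \in [set: dyadic d]) lam Q * atom (f Q) Q x : Rcomplex R| ^+ 2 =
    F ReL x ^+ 2 + F ImL x ^+ 2.
  rewrite (@fsbigTE _ _ _ _ S); last by move=> Q /lam0 ->; rewrite mul0r.
  rewrite Rcomplex_norm_sqr -[complex.Re _]/(ReL _) -[complex.Im _]/(ImL _).
  by rewrite !linear_sum.
under eq_integral do rewrite FE EFinD.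
have mF (rho : {linear Rcomplex R -> R}) : (forall z, `|rho z| <= `|z|) ->
    measurable_fun [set: 'rV[R]_d] (fun x => (F rho x ^+ 2)%:E).
  move=> rho_le; apply/measurable_EFinP; apply: measurable_funX.
  apply: measurable_sum => Q; apply/measurable_EFinP.
  apply: measurable_int.
  exact: (integrable_atom_part d_gt0 eps_gt0 C1_gt0 df f_decay lam rho Q).
rewrite ge0_integralD//; last 4 first.
- by move=> x _; rewrite lee_fin sqr_ge0.
- exact: mF Re_le_norm.
- by move=> x _; rewrite lee_fin sqr_ge0.
- exact: mF Im_le_norm.
rewrite -mulrA mulr_natl mulr2n EFinD.
by apply: leeD; apply: integral_sqr_part => //;
  [exact: Re_le_norm|exact: fset_uniq|exact: Im_le_norm|exact: fset_uniq].
Qed.
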